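(* Let $0<p\le\infty$ and $0<\alpha<\infty$. No non-trivial semigroup of analytic functions induces a strongly continuous semigroup of composition operators on $H(p,\infty,\alpha)$. In other words, $[\varphi_t,H(p,\infty,\alpha)]\subsetneq H(p,\infty,\alpha)$ for every non-trivial semigroup of analytic functions $(\varphi_t)$.
   Context: A semigroup of analytic functions is a family $\{\varphi_t:t\ge0\}$ of analytic self-maps of the unit disk $\mathbb{D}$ with $\varphi_0=\mathrm{id}$, $\varphi_{t+s}=\varphi_t\circ\varphi_s$, and $\varphi_t\to\varphi_0$ uniformly on compact subsets as $t\to0^+$; it is trivial if all $\varphi_t$ are the identity. $M_p(r,f)=\left(\int_0^{2\pi}|f(re^{i\theta})|^p\frac{d\theta}{2\pi}\right)^{1/p}$ ($p<\infty$), $M_\infty(r,f)=\max_\theta|f(re^{i\theta})|$; $H(p,\infty,\alpha)$ is the space of analytic $f$ on $\mathbb{D}$ with $\|f\|_{p,\infty,\alpha}=\sup_{0\le r<1}(1-r)^\alpha M_p(r,f)<\infty$. For a space $X$, $[\varphi_t,X]=\{f\in X:\|f\circ\varphi_t-f\|_X\to0\text{ as }t\to0^+\}$. *)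

(* Defs.v *)
From Stdlib Require Import Reals.
From Coquelicot Require Import Coquelicot.
Open Scope R_scope.

Definition in_disk (z : C) : Prop := Cmod z < 1.

Definition analytic_on_disk (f : C -> C) : Prop :=
  forall z : C, in_disk z -> ex_derive (K := C_AbsRing) (V := C_NormedModule) f z.

(* x^y for x >= 0, y > 0, with the convention 0^y = 0
   (Stdlib's Rpower 0 y would be exp 0 = 1). *)
Definition rpow (x y : R) : R := if Rle_dec x 0 then 0 else Rpower x y.

Definition polar (r th : R) : C := (r * cos th, r * sin th).

Definition Mp (p : Rbar) (r : R) (f : C -> C) : R :=
  match p with
  | Finite q => rpow (RInt (fun th => rpow (Cmod (f (polar r th))) q) 0 (2 * PI) / (2 * PI)) (1 / q)
  | _ => real (Lub_Rbar (fun x => exists th : R, x = Cmod (f (polar r th))))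
  end.

Definition Hnorm (p : Rbar) (alpha : R) (f : C -> C) : Rbar :=
  Lub_Rbar (fun x => exists r : R, 0 <= r < 1 /\ x = Rpower (1 - r) alpha * Mp p r f).

Definition in_H (p : Rbar) (alpha : R) (f : C -> C) : Prop :=
  analytic_on_disk f /\ Rbar_lt (Hnorm p alpha f) p_infty.

Definition analytic_semigroup (phi : R -> C -> C) : Prop :=
  (forall t, 0 <= t -> analytic_on_disk (phi t)) /\
  (forall t z, 0 <= t -> in_disk z -> in_disk (phi t z)) /\
  (forall z, in_disk z -> phi 0 z = z) /\
  (forall t s z, 0 <= t -> 0 <= s -> in_disk z -> phi (t + s) z = phi t (phi s z)) /\
  (* phi_t -> id uniformly on compact subsets of D as t -> 0+
     (every compact subset of D lies in some closed disk |z| <= r, r < 1) *)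
  (forall r eps, 0 <= r < 1 -> 0 < eps -> exists delta, 0 < delta /\
     forall t z, 0 < t < delta -> Cmod z <= r -> Cmod (Cminus (phi t z) z) < eps).

Definition trivial_semigroup (phi : R -> C -> C) : Prop :=
  forall t z, 0 <= t -> in_disk z -> phi t z = z.

Definition in_strong_cont (p : Rbar) (alpha : R) (phi : R -> C -> C) (f : C -> C) : Prop :=
  in_H p alpha f /\
  forall eps, 0 < eps -> exists delta, 0 < delta /\
    forall t, 0 < t < delta ->
      Rbar_le (Hnorm p alpha (fun z => Cminus (f (phi t z)) (f z))) (Finite eps).

(* Main.v *)
Require Import Defs.
From Stdlib Require Import Reals Lra Lia Psatz ClassicalEpsilon FunctionalExtensionality Wf_nat.
From Coquelicot Require Import Coquelicot.
Open Scope R_scope.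

(** Write kappa = alpha + 1/p.  Point evaluations satisfy
    (1 - |a|)^kappa |h(a)| <= C ||h||, and the normalised kernels
    K_a(z) = (1 - |a|)^(N - kappa) / (1 - conj(a) z)^N are bounded in
    H(p, infinity, alpha) while (1 - |a|)^kappa |K_a(a)| >= 2^(-N).  If phi_t is
    not the identity, the Cauchy estimate applied to phi_t(z) - z gives d > 0 and,
    on every circle close to the boundary, a point a with |phi_t(a) - a| >= d; as
    1 - |a| tends to 0, (1 - |a|)^kappa K_a(phi_t(a)) tends to 0, so K_a o phi_t
    stays away from K_a in norm.  A non-trivial semigroup has such times
    t_n -> 0, and f = sum_n K_{a_n} with 1 - |a_n| decreasing fast enough
    stays in the space (on each circle at most two terms are not negligible in
    sup norm) while ||f o phi_{t_n} - f|| is bounded below.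

    Analyticity is mere complex differentiability, so Cauchy's estimate is
    derived from Goursat's theorem. *)

(** * Complex differentiability *)

(** The range p < 1 shapes the argument. There M_p obeys no triangle inequality, so the series for f
    cannot be summed in norm; on each circle two kernels are kept in M_p and all others are bounded
    in supremum, which leaves a sum of three terms. The integer N must satisfy N >= kappa + 1, so
    that on a fixed smaller disk a kernel is at most a constant times 1 - |a|, and N p >= 2, so that
    the integral of its p-th power reduces to that of |1 - conj(a) z|^(-2), which the mean value
    property evaluates. The kernel is small at phi_t(a) because 1 - conj(a) phi_t(a) = conj(a) (a -
    phi_t(a)) + (1 - |a|^2) stays away from 0, and (1 - |a|)^kappa |K_a(phi_t(a))| is the N-th power
    of (1 - |a|) / |1 - conj(a) phi_t(a)|. One kernel detects one time t only, hence a sum over a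
    sequence of times. *)

Definition cderiv (f : C -> C) (z l : C) : Prop :=
  forall eps, 0 < eps -> exists d, 0 < d /\ forall w : C,
    Cmod (w - z)%C < d -> Cmod (f w - f z - l * (w - z))%C <= eps * Cmod (w - z)%C.

Lemma cderiv_is_derive (f : C -> C) (z l : C) :
  is_derive (K := C_AbsRing) (V := C_NormedModule) f z l <-> cderiv f z l.
Proof.
split.
- intros [_ H] eps Heps.
  specialize (H z (fun P HP => HP) (mkposreal eps Heps)).
  destruct H as [d Hd].
  exists d; split; [apply cond_pos|intros w Hw].
  specialize (Hd w Hw).
  replace (f w - f z - l * (w - z))%C with (f w - f z - (w - z) * l)%C by ring.
  exact Hd.
- intros H; split.
  + apply is_linear_scal_l.
  + intros x Hx eps.
    pose proof (@is_filter_lim_locally_unique C_AbsRing (AbsRing_NormedModule C_AbsRing) z x Hx) as <-; clear Hx.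
    destruct (H eps (cond_pos eps)) as [d [Hd H']].
    exists (mkposreal d Hd); intros w Hw.
    specialize (H' w Hw).
    replace (f w - f z - l * (w - z))%C with (f w - f z - (w - z) * l)%C in H' by ring.
    exact H'.
Qed.

(* C_NormedModule and AbsRing_NormedModule C_AbsRing are not convertible, and
   Coquelicot's product and chain rules use the latter. *)
Lemma cderiv_is_derive_AbsRing (f : C -> C) (z l : C) :
  is_derive (K := C_AbsRing) (V := AbsRing_NormedModule C_AbsRing) f z l <-> cderiv f z l.
Proof.
split.
- intros [_ H] eps Heps.
  specialize (H z (fun P HP => HP) (mkposreal eps Heps)).
  destruct H as [d Hd].
  exists d; split; [apply cond_pos|intros w Hw].
  specialize (Hd w Hw).
  replace (f w - f z - l * (w - z))%C with (f w - f z - (w - z) * l)%C by ring.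
  exact Hd.
- intros H; split.
  + apply is_linear_scal_l.
  + intros x Hx eps.
    pose proof (@is_filter_lim_locally_unique C_AbsRing (AbsRing_NormedModule C_AbsRing) z x Hx) as <-; clear Hx.
    destruct (H eps (cond_pos eps)) as [d [Hd H']].
    exists (mkposreal d Hd); intros w Hw.
    specialize (H' w Hw).
    replace (f w - f z - l * (w - z))%C with (f w - f z - (w - z) * l)%C in H' by ring.
    exact H'.
Qed.

Lemma ex_derive_cderiv (f : C -> C) (z : C) :
  ex_derive (K := C_AbsRing) (V := C_NormedModule) f z <-> exists l, cderiv f z l.
Proof.
split; intros [l H]; exists l; now apply cderiv_is_derive.
Qed.

Lemma cderiv_cont (f : C -> C) (z l : C) : cderiv f z l ->
  forall eps, 0 < eps -> exists d, 0 < d /\ forall w : C,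
    Cmod (w - z)%C < d -> Cmod (f w - f z)%C < eps.
Proof.
intros H eps Heps.
destruct (H 1 Rlt_0_1) as [d [Hd H1]].
pose proof (Cmod_ge_0 l) as Hl.
assert (Hk : 0 < eps / (Cmod l + 2)) by (apply Rdiv_lt_0_compat; lra).
exists (Rmin d (eps / (Cmod l + 2))); split; [now apply Rmin_glb_lt|].
intros w Hw.
assert (Hw1 : Cmod (w - z)%C < d) by (eapply Rlt_le_trans; [exact Hw|apply Rmin_l]).
assert (Hw2 : Cmod (w - z)%C < eps / (Cmod l + 2))
  by (eapply Rlt_le_trans; [exact Hw|apply Rmin_r]).
specialize (H1 w Hw1).
replace (f w - f z)%C with ((f w - f z - l * (w - z)) + l * (w - z))%C by ring.
eapply Rle_lt_trans; [apply Cmod_triangle|].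
rewrite Cmod_mult.
apply (Rmult_lt_compat_r (Cmod l + 2)) in Hw2; [|lra].
unfold Rdiv in Hw2; rewrite Rmult_assoc, Rinv_l, Rmult_1_r in Hw2 by lra.
pose proof (Cmod_ge_0 (w - z)%C). nra.
Qed.

Lemma cderiv_mult (f g : C -> C) (z l m : C) : cderiv f z l -> cderiv g z m ->
  cderiv (fun w => f w * g w)%C z (l * g z + f z * m)%C.
Proof.
rewrite <- !cderiv_is_derive_AbsRing; intros Hf Hg.
apply (is_derive_mult (K := C_AbsRing) f g z l m Hf Hg).
intros; apply Cmult_comm.
Qed.

Lemma cderiv_minus (f g : C -> C) (z l m : C) : cderiv f z l -> cderiv g z m ->
  cderiv (fun w => f w - g w)%C z (l - m)%C.
Proof.
rewrite <- !cderiv_is_derive; intros Hf Hg.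
apply (is_derive_minus (K := C_AbsRing) (V := C_NormedModule) f g z l m Hf Hg).
Qed.

Lemma cderiv_comp (f g : C -> C) (z l m : C) : cderiv f (g z) l -> cderiv g z m ->
  cderiv (fun w => f (g w)) z (m * l)%C.
Proof.
rewrite <- (cderiv_is_derive f), <- (cderiv_is_derive (fun w => f (g w))),
  <- (cderiv_is_derive_AbsRing g); intros Hf Hg.
apply (is_derive_comp (K := C_AbsRing) (V := C_NormedModule) f g z l m Hf Hg).
Qed.

Lemma cderiv_affine (a b z : C) : cderiv (fun w => a * w + b)%C z a.
Proof.
intros eps Heps; exists 1; split; [lra|intros w _].
replace (a * w + b - (a * z + b) - a * (w - z))%C with (RtoC 0) by ring.
rewrite Cmod_0; apply Rmult_le_pos; [lra|apply Cmod_ge_0].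
Qed.

Lemma Cmod_triangle_inv (x y : C) : Cmod x - Cmod y <= Cmod (x - y)%C.
Proof.
pose proof (Cmod_triangle (x - y)%C y) as H.
replace (x - y + y)%C with x in H by ring. lra.
Qed.

Lemma Cmod_sub_le (x y : C) : Cmod (x - y)%C <= Cmod x + Cmod y.
Proof.
pose proof (Cmod_triangle x (- y)%C) as H. rewrite Cmod_opp in H. exact H.
Qed.

Lemma Cmod_sub_sym (x y : C) : Cmod (x - y)%C = Cmod (y - x)%C.
Proof. replace (x - y)%C with (- (y - x))%C by ring; apply Cmod_opp. Qed.

Lemma cderiv_inv (z : C) : z <> 0%C -> cderiv (fun w => / w)%C z (- / (z * z))%C.
Proof.
intros Hz eps Heps.
assert (Hm : 0 < Cmod z) by now apply Cmod_gt_0.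
set (m := Cmod z) in *.
assert (Hm3 : 0 < m * m * m) by (apply Rmult_lt_0_compat; nra).
(* The remainder is (w - z)^2 / (z^2 w). The first bound gives |w| > m / 2, so the remainder is at
   most 2 |w - z|^2 / m^3, and the second bound turns this into eps |w - z|. *)
exists (Rmin (m / 2) (eps * (m * m * m) / 2)); split.
{ apply Rmin_glb_lt; [lra|]. apply Rdiv_lt_0_compat; nra. }
intros w Hw.
assert (Hw1 : Cmod (w - z)%C < m / 2) by (eapply Rlt_le_trans; [exact Hw|apply Rmin_l]).
assert (Hw2 : Cmod (w - z)%C < eps * (m * m * m) / 2)
  by (eapply Rlt_le_trans; [exact Hw|apply Rmin_r]).
assert (Hwm : m / 2 < Cmod w).
{ pose proof (Cmod_triangle_inv z w) as H; rewrite Cmod_sub_sym in H; fold m in H; lra. }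
assert (Hw0 : w <> 0%C) by (apply Cmod_gt_0; lra).
replace (/ w - / z - - / (z * z) * (w - z))%C
  with ((w - z) * ((w - z) * / (z * z * w)))%C by (field; auto).
rewrite Cmod_mult, Rmult_comm.
apply Rmult_le_compat_r; [apply Cmod_ge_0|].
rewrite Cmod_mult, Cmod_inv, !Cmod_mult by (repeat apply Cmult_neq_0; auto).
fold m.
assert (Hp : 0 < m * m * Cmod w) by (apply Rmult_lt_0_compat; nra).
apply (Rmult_le_reg_r (m * m * Cmod w)); [exact Hp|].
rewrite Rmult_assoc, Rinv_l, Rmult_1_r by lra.
assert (m * m * m / 2 <= m * m * Cmod w) by nra.
nra.
Qed.

Lemma cderiv_pow (f : C -> C) (z : C) (n : nat) : (exists l, cderiv f z l) ->
  exists l, cderiv (fun w => f w ^ n)%C z l.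
Proof.
intros [l Hl]; induction n as [|n [m Hm]].
- exists 0%C. intros eps Heps; exists 1; split; [lra|intros w _]; simpl.
  replace (1 - 1 - 0 * (w - z))%C with (RtoC 0) by ring.
  rewrite Cmod_0; apply Rmult_le_pos; [lra|apply Cmod_ge_0].
- eexists. exact (cderiv_mult f (fun w => f w ^ n)%C z l m Hl Hm).
Qed.

(** * Continuity of complex-valued functions of a real variable *)

Lemma continuous_C (g : R -> C) (x : R) :
  (forall eps, 0 < eps -> exists d, 0 < d /\ forall y, Rabs (y - x) < d ->
     Cmod (g y - g x)%C < eps) ->
  continuous (T := R_UniformSpace) (U := C_UniformSpace) g x.
Proof.
intros H.
apply filterlim_locally; intros eps.
destruct (H eps (cond_pos eps)) as [d [Hd H']].
exists (mkposreal d Hd); intros y Hy.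
apply C_NormedModule_mixin_compat1, H', Hy.
Qed.

Lemma continuous_C_elim (g : R -> C) (x : R) :
  continuous (T := R_UniformSpace) (U := C_UniformSpace) g x ->
  forall eps, 0 < eps -> exists d, 0 < d /\ forall y, Rabs (y - x) < d ->
     Cmod (g y - g x)%C < eps.
Proof.
intros H eps Heps.
(* The uniform structure of C is that of a product, whose balls of radius r only give modulus less
   than sqrt 2 times r. *)
assert (Hs : 0 < sqrt 2) by (apply sqrt_lt_R0; lra).
assert (He : 0 < eps / sqrt 2) by now apply Rdiv_lt_0_compat.
apply filterlim_locally with (eps := mkposreal _ He) in H.
destruct H as [d H].
exists d; split; [apply cond_pos|intros y Hy].
specialize (H y Hy).
apply C_NormedModule_mixin_compat2 in H; simpl in H.
replace (sqrt 2 * (eps / sqrt 2)) with eps in H by (field; lra).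
exact H.
Qed.

Lemma continuous_cderiv_comp (f : C -> C) (g : R -> C) (x : R) (l : C) :
  cderiv f (g x) l ->
  continuous (T := R_UniformSpace) (U := C_UniformSpace) g x ->
  continuous (T := R_UniformSpace) (U := C_UniformSpace) (fun y => f (g y)) x.
Proof.
intros Hf Hg; apply continuous_C; intros eps Heps.
destruct (cderiv_cont _ _ _ Hf eps Heps) as [d [Hd H1]].
destruct (continuous_C_elim _ _ Hg d Hd) as [d' [Hd' H2]].
exists d'; split; [exact Hd'|intros y Hy; apply H1, H2, Hy].
Qed.

Lemma continuous_C_pair (u v : R -> R) (x : R) :
  continuous u x -> continuous v x ->
  continuous (T := R_UniformSpace) (U := C_UniformSpace) (fun y => (u y, v y) : C) x.
Proof.
intros Hu Hv.
apply (continuous_comp_2 u v (fun a b => (a, b) : C) x Hu Hv).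
simpl. apply (continuous_ext (fun z : R * R => z)); [now intros []|apply continuous_id].
Qed.

Lemma continuous_C_Re (g : R -> C) (x : R) :
  continuous (T := R_UniformSpace) (U := C_UniformSpace) g x ->
  continuous (fun y => fst (g y)) x /\ continuous (fun y => snd (g y)) x.
Proof.
intros H; split; apply (continuous_comp (V := C_UniformSpace)); auto;
destruct (g x); [apply continuous_fst|apply continuous_snd].
Qed.

Lemma continuous_C_mult (f g : R -> C) (x : R) :
  continuous (T := R_UniformSpace) (U := C_UniformSpace) f x ->
  continuous (T := R_UniformSpace) (U := C_UniformSpace) g x ->
  continuous (T := R_UniformSpace) (U := C_UniformSpace) (fun y => f y * g y)%C x.
Proof.
intros Hf Hg.
destruct (continuous_C_Re f x Hf) as [f1 f2]; destruct (continuous_C_Re g x Hg) as [g1 g2].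
apply continuous_C_pair.
- apply (continuous_minus (fun y => fst (f y) * fst (g y)) (fun y => snd (f y) * snd (g y)) x);
  [apply (continuous_mult (fun y => fst (f y)) (fun y => fst (g y)) x)
  |apply (continuous_mult (fun y => snd (f y)) (fun y => snd (g y)) x)]; auto.
- apply (continuous_plus (fun y => fst (f y) * snd (g y)) (fun y => snd (f y) * fst (g y)) x);
  [apply (continuous_mult (fun y => fst (f y)) (fun y => snd (g y)) x)
  |apply (continuous_mult (fun y => snd (f y)) (fun y => fst (g y)) x)]; auto.
Qed.

Lemma continuous_Cmod (g : R -> C) (x : R) :
  continuous (T := R_UniformSpace) (U := C_UniformSpace) g x ->
  continuous (fun y => Cmod (g y)) x.
Proof.
intros H. apply filterlim_locally; intros eps.
destruct (continuous_C_elim _ _ H eps (cond_pos eps)) as [d [Hd H']].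
exists (mkposreal d Hd); intros y Hy.
specialize (H' y Hy). change (Rabs (Cmod (g y) - Cmod (g x)) < eps).
pose proof (Cmod_triangle_inv (g y) (g x)); pose proof (Cmod_triangle_inv (g x) (g y)) as H2.
rewrite Cmod_sub_sym in H2. apply Rabs_lt_between; lra.
Qed.

(** * Complex-valued integrals and the bisection of rectangles *)

Definition CInt (g : R -> C) (a b : R) : C := RInt (V := C_R_CompleteNormedModule) g a b.

Notation ccontinuous := (continuous (T := R_UniformSpace) (U := C_UniformSpace)).

Lemma ex_CInt (g : R -> C) (a b : R) : a <= b ->
  (forall x, a <= x <= b -> ccontinuous g x) ->
  ex_RInt (V := C_R_CompleteNormedModule) g a b.
Proof.
intros Hab H. apply (ex_RInt_continuous (V := C_R_CompleteNormedModule)).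
intros z Hz. apply H. rewrite Rmin_left, Rmax_right in Hz; auto.
Qed.

Lemma CInt_Chasles (g : R -> C) (a b c : R) : a <= b -> b <= c ->
  (forall x, a <= x <= c -> ccontinuous g x) ->
  CInt g a c = (CInt g a b + CInt g b c)%C.
Proof.
intros Hab Hbc H. symmetry.
apply (RInt_Chasles (V := C_R_CompleteNormedModule) g a b c);
apply ex_CInt; auto; intros x Hx; apply H; lra.
Qed.

Lemma CInt_minus (f g : R -> C) (a b : R) : a <= b ->
  (forall x, a <= x <= b -> ccontinuous f x) ->
  (forall x, a <= x <= b -> ccontinuous g x) ->
  CInt (fun x => f x - g x)%C a b = (CInt f a b - CInt g a b)%C.
Proof.
intros Hab Hf Hg.
apply (RInt_minus (V := C_R_CompleteNormedModule) f g a b); now apply ex_CInt.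
Qed.

Lemma CInt_bound (g : R -> C) (a b M : R) : a <= b ->
  (forall x, a <= x <= b -> ccontinuous g x) ->
  (forall x, a <= x <= b -> Cmod (g x) <= M) ->
  Cmod (CInt g a b) <= (b - a) * M.
Proof.
intros Hab Hg HM.
rewrite Cmod_norm.
apply (norm_RInt_le_const (V := C_R_NormedModule) g a b); auto.
- intros x Hx; rewrite <- Cmod_norm; auto.
- apply (RInt_correct (V := C_R_CompleteNormedModule)), ex_CInt; auto.
Qed.

Lemma Cmod_CInt_le (g : R -> C) (a b : R) : a <= b ->
  (forall x, a <= x <= b -> ccontinuous g x) ->
  Cmod (CInt g a b) <= RInt (fun x => Cmod (g x)) a b.
Proof.
intros Hab Hg.
rewrite Cmod_norm.
apply (norm_RInt_le (V := C_R_NormedModule) g (fun x => Cmod (g x)) a b); auto.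
- intros x Hx; rewrite <- Cmod_norm; lra.
- apply (RInt_correct (V := C_R_CompleteNormedModule)), ex_CInt; auto.
- apply (RInt_correct (V := R_CompleteNormedModule)).
  apply (ex_RInt_continuous (V := R_CompleteNormedModule)); intros z Hz.
  rewrite Rmin_left, Rmax_right in Hz by lra. apply continuous_Cmod, Hg, Hz.
Qed.

Lemma CInt_ext (f g : R -> C) (a b : R) : a <= b ->
  (forall x, a <= x <= b -> f x = g x) -> CInt f a b = CInt g a b.
Proof.
intros Hab H. apply (RInt_ext (V := C_R_CompleteNormedModule)).
intros x Hx; rewrite Rmin_left, Rmax_right in Hx by lra; apply H; lra.
Qed.

Lemma CInt_const (k : C) (a b : R) : CInt (fun _ => k) a b = (RtoC (b - a) * k)%C.
Proof.
unfold CInt. rewrite (RInt_const (V := C_R_CompleteNormedModule)).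
exact (scal_R_Cmult (b - a) k).
Qed.

Lemma CInt_derive (f1 f2 g1 g2 : R -> R) (a b : R) :
  (forall x, is_derive f1 x (g1 x)) -> (forall x, is_derive f2 x (g2 x)) ->
  (forall x, continuous g1 x) -> (forall x, continuous g2 x) ->
  CInt (fun x => (g1 x, g2 x)) a b = (f1 b - f1 a, f2 b - f2 a).
Proof.
intros H1 H2 c1 c2.
apply (is_RInt_unique (V := C_R_CompleteNormedModule)).
apply (is_RInt_fct_extend_pair (U := R_NormedModule) (V := R_NormedModule)); simpl.
- apply (is_RInt_derive (V := R_CompleteNormedModule) f1 g1); auto.
- apply (is_RInt_derive (V := R_CompleteNormedModule) f2 g2); auto.
Qed.

Lemma CInt_re (g : R -> C) (a b : R) : a <= b ->
  (forall x, a <= x <= b -> ccontinuous g x) ->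
  fst (CInt g a b) = RInt (fun x => fst (g x)) a b.
Proof.
intros Hab Hg.
apply ex_CInt in Hg; auto.
destruct Hg as [l Hl].
assert (E : CInt g a b = l) by exact (is_RInt_unique (V := C_R_CompleteNormedModule) _ _ _ _ Hl).
rewrite E. symmetry.
apply (is_RInt_unique (V := R_CompleteNormedModule)).
destruct l as [l1 l2].
apply (is_RInt_fct_extend_fst (U := R_NormedModule) (V := R_NormedModule) g a b (l1, l2) Hl).
Qed.

Section Bisection.

(** [D x1 x2 y1 y2] models a contour integral around the rectangle [x1, x2] x [y1, y2]. [Hadd] is
    additivity under quartering, with corners spelled [x + a + a] so that each quarter again has the
    form corner plus side. [Hloc] says that [D] is o(area) at every point; it allows any small
    rectangle containing the point, because the limit of nested rectangles need not be a centre. *)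
Variables (D : R -> R -> R -> R -> C) (x0 y0 A B : R).
Hypothesis HA : 0 <= A.
Hypothesis HB : 0 <= B.
Hypothesis Hadd : forall x y a b, 0 <= a -> 0 <= b ->
  x0 <= x -> x + 2 * a <= x0 + A -> y0 <= y -> y + 2 * b <= y0 + B ->
  D x (x + 2 * a) y (y + 2 * b) =
  (D x (x + a) y (y + b) + D (x + a) (x + a + a) y (y + b) +
   D x (x + a) (y + b) (y + b + b) + D (x + a) (x + a + a) (y + b) (y + b + b))%C.
Hypothesis Hloc : forall x y, x0 <= x <= x0 + A -> y0 <= y <= y0 + B ->
  forall eps, 0 < eps -> exists d, 0 < d /\ forall x' y' s, 0 < s < d ->
    x0 <= x' -> x' + s * A <= x0 + A -> y0 <= y' -> y' + s * B <= y0 + B ->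
    x' <= x <= x' + s * A -> y' <= y <= y' + s * B ->
    Cmod (D x' (x' + s * A) y' (y' + s * B)) <= eps * s ^ 2.

Let bad (eta s : R) (q : R * R) : Prop :=
  x0 <= fst q /\ fst q + s * A <= x0 + A /\ y0 <= snd q /\ snd q + s * B <= y0 + B /\
  eta * s ^ 2 <= Cmod (D (fst q) (fst q + s * A) (snd q) (snd q + s * B)).

Let sub (s : R) (q q' : R * R) : Prop :=
  fst q <= fst q' /\ fst q' + s / 2 * A <= fst q + s * A /\
  snd q <= snd q' /\ snd q' + s / 2 * B <= snd q + s * B.

Lemma bad_step eta s q : 0 < s -> bad eta s q ->
  exists q', bad eta (s / 2) q' /\ sub s q q'.
Proof.
intros Hs (H1 & H2 & H3 & H4 & H5). destruct q as [x y]; simpl in *.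
set (a := s / 2 * A) in *; set (b := s / 2 * B) in *.
assert (Ha : 0 <= a) by (unfold a; apply Rmult_le_pos; lra).
assert (Hb : 0 <= b) by (unfold b; apply Rmult_le_pos; lra).
assert (EA : s * A = 2 * a) by (unfold a; field).
assert (EB : s * B = 2 * b) by (unfold b; field).
rewrite EA, EB in *.
rewrite Hadd in H5 by lra.
destruct (Rle_lt_dec (eta * (s / 2) ^ 2) (Cmod (D x (x + a) y (y + b)))) as [K1|K1].
{ exists (x, y); unfold bad, sub; simpl; rewrite ?EA, ?EB; fold a; fold b; repeat split; try exact K1; try lra. }
destruct (Rle_lt_dec (eta * (s / 2) ^ 2) (Cmod (D (x + a) (x + a + a) y (y + b)))) as [K2|K2].
{ exists (x + a, y); unfold bad, sub; simpl; rewrite ?EA, ?EB; fold a; fold b; repeat split; try exact K2; try lra. }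
destruct (Rle_lt_dec (eta * (s / 2) ^ 2) (Cmod (D x (x + a) (y + b) (y + b + b)))) as [K3|K3].
{ exists (x, y + b); unfold bad, sub; simpl; rewrite ?EA, ?EB; fold a; fold b; repeat split; try exact K3; try lra. }
destruct (Rle_lt_dec (eta * (s / 2) ^ 2) (Cmod (D (x + a) (x + a + a) (y + b) (y + b + b)))) as [K4|K4].
{ exists (x + a, y + b); unfold bad, sub; simpl; rewrite ?EA, ?EB; fold a; fold b; repeat split; try exact K4; try lra. }
(* Four quarters, each below [eta * (s / 2) ^ 2], would add up to less than [eta * s ^ 2]. *)
exfalso.
pose proof (Cmod_triangle (D x (x + a) y (y + b) + D (x + a) (x + a + a) y (y + b) +
   D x (x + a) (y + b) (y + b + b))%C (D (x + a) (x + a + a) (y + b) (y + b + b))).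
pose proof (Cmod_triangle (D x (x + a) y (y + b) + D (x + a) (x + a + a) y (y + b))%C
   (D x (x + a) (y + b) (y + b + b))).
pose proof (Cmod_triangle (D x (x + a) y (y + b)) (D (x + a) (x + a + a) y (y + b))).
replace (eta * s ^ 2) with (4 * (eta * (s / 2) ^ 2)) in H5 by field.
lra.
Qed.

(** A non-zero value would be inherited, in proportion to area, by a nested sequence of quarters; at
    their common point this contradicts [Hloc]. *)
Lemma rectangle_bisection : D x0 (x0 + A) y0 (y0 + B) = 0%C.
Proof.
apply Cmod_eq_0, NNPP; intros Hne.
set (eta := Cmod (D x0 (x0 + A) y0 (y0 + B))) in *.
assert (Heta : 0 < eta) by (unfold eta in *; pose proof (Cmod_ge_0 (D x0 (x0 + A) y0 (y0 + B))); lra).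
(* The hypotheses stand under the existential, so that choice yields a total function, which the
   recursion below can iterate. *)
assert (Hstep : forall (sq : R * (R * R)), exists q', 0 < fst sq -> bad eta (fst sq) (snd sq) ->
   bad eta (fst sq / 2) q' /\ sub (fst sq) (snd sq) q').
{ intros [s q]; simpl. destruct (classic (0 < s /\ bad eta s q)) as [[Hs Hq]|Hn].
  - destruct (bad_step eta s q Hs Hq) as [q' Hq']; exists q'; auto.
  - exists (0, 0); intros; exfalso; auto. }
set (nxt := fun sq => proj1_sig (constructive_indefinite_description _ (Hstep sq))).
assert (Hnxt : forall s q, 0 < s -> bad eta s q -> bad eta (s / 2) (nxt (s, q)) /\ sub s q (nxt (s, q))).
{ intros s q. unfold nxt. destruct (constructive_indefinite_description _ (Hstep (s, q))) as [q' Hq'].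
  exact Hq'. }
clearbody nxt.
set (q := fix q n := match n with O => (x0, y0) | S n => nxt ((/ 2) ^ n, q n) end).
assert (Hpos : forall n, 0 < (/ 2) ^ n) by (intros n; apply pow_lt; lra).
assert (Hbad : forall n, bad eta ((/ 2) ^ n) (q n)).
{ induction n as [|n IH].
  - unfold bad; simpl. rewrite !Rmult_1_l. repeat split; try lra. unfold eta; lra.
  - replace ((/ 2) ^ S n) with ((/ 2) ^ n / 2) by (simpl; field).
    apply (Hnxt _ _ (Hpos n) IH). }
assert (Hsub : forall n, sub ((/ 2) ^ n) (q n) (q (S n))) by (intros n; apply (Hnxt _ _ (Hpos n) (Hbad n))).
assert (Hmon : forall n m, fst (q n) <= fst (q (n + m)%nat) /\
   fst (q (n + m)%nat) + (/ 2) ^ (n + m) * A <= fst (q n) + (/ 2) ^ n * A /\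
   snd (q n) <= snd (q (n + m)%nat) /\
   snd (q (n + m)%nat) + (/ 2) ^ (n + m) * B <= snd (q n) + (/ 2) ^ n * B).
{ intros n; induction m as [|m IH].
  - rewrite Nat.add_0_r; lra.
  - rewrite Nat.add_succ_r. pose proof (Hsub (n + m)%nat) as (S1 & S2 & S3 & S4).
    replace ((/ 2) ^ S (n + m)) with ((/ 2) ^ (n + m) / 2) by (simpl; field). lra. }
destruct (ex_finite_lim_seq_incr (fun n => fst (q n)) (x0 + A)) as [X HX].
{ intros n; apply (Hsub n). }
{ intros n; pose proof (Hbad n) as (? & ? & _); pose proof (Hpos n); nra. }
destruct (ex_finite_lim_seq_incr (fun n => snd (q n)) (y0 + B)) as [Y HY].
{ intros n; apply (Hsub n). }
{ intros n; pose proof (Hbad n) as (? & ? & ? & ? & _); pose proof (Hpos n); nra. }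
assert (HXn : forall n, fst (q n) <= X <= fst (q n) + (/ 2) ^ n * A).
{ intros n; split.
  - apply (is_lim_seq_incr_compare (fun n => fst (q n)) X HX); intros k; apply (Hsub k).
  - apply (is_lim_seq_incr_n _ n) in HX.
    apply (is_lim_seq_le (fun m => fst (q (m + n)%nat)) (fun _ => fst (q n) + (/ 2) ^ n * A) X
      (fst (q n) + (/ 2) ^ n * A)); [|exact HX|apply is_lim_seq_const].
    intros m; rewrite Nat.add_comm. pose proof (Hmon n m) as (? & ? & ? & ?).
    pose proof (Hpos (n + m)%nat); nra. }
assert (HYn : forall n, snd (q n) <= Y <= snd (q n) + (/ 2) ^ n * B).
{ intros n; split.
  - apply (is_lim_seq_incr_compare (fun n => snd (q n)) Y HY); intros k; apply (Hsub k).
  - apply (is_lim_seq_incr_n _ n) in HY.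
    apply (is_lim_seq_le (fun m => snd (q (m + n)%nat)) (fun _ => snd (q n) + (/ 2) ^ n * B) Y
      (snd (q n) + (/ 2) ^ n * B)); [|exact HY|apply is_lim_seq_const].
    intros m; rewrite Nat.add_comm. pose proof (Hmon n m) as (? & ? & ? & ?).
    pose proof (Hpos (n + m)%nat); nra. }
(* Half of [eta] is enough: for a scale 2^-n below [d] the bound [eta / 2 * s ^ 2] contradicts
   [bad]. *)
destruct (Hloc X Y) with (eps := eta / 2) as [d [Hd HH]].
{ pose proof (HXn 0%nat) as H; simpl in H; lra. }
{ pose proof (HYn 0%nat) as H; simpl in H; lra. }
{ lra. }
assert (Hg : is_lim_seq (fun n => (/ 2) ^ n) 0) by (apply is_lim_seq_geom; rewrite Rabs_pos_eq; lra).
apply is_lim_seq_spec in Hg. destruct (Hg (mkposreal d Hd)) as [n Hn]; simpl in Hn.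
specialize (Hn n (le_n n)). rewrite Rminus_0_r, Rabs_pos_eq in Hn by (left; apply Hpos).
pose proof (Hbad n) as (B1 & B2 & B3 & B4 & B5).
specialize (HH (fst (q n)) (snd (q n)) ((/ 2) ^ n) (conj (Hpos n) Hn) B1 B2 B3 B4 (HXn n) (HYn n)).
pose proof (pow_lt ((/ 2) ^ n) 2 (Hpos n)). nra.
Qed.

End Bisection.

(** * Goursat's theorem for a circle shrinking to a point *)

Definition dpolar (r th : R) : C := (- r * sin th, r * cos th).

Lemma Cmod_polar (r th : R) : 0 <= r -> Cmod (polar r th) = r.
Proof.
intros Hr. unfold Cmod, polar; simpl.
replace (r * cos th * (r * cos th * 1) + r * sin th * (r * sin th * 1))
  with (r * r * (Rsqr (sin th) + Rsqr (cos th))) by (unfold Rsqr; ring).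
rewrite sin2_cos2, Rmult_1_r. now apply sqrt_square.
Qed.

Lemma Cmod_dpolar (r th : R) : 0 <= r -> Cmod (dpolar r th) = r.
Proof.
intros Hr. unfold Cmod, dpolar; simpl.
replace (- r * sin th * (- r * sin th * 1) + r * cos th * (r * cos th * 1))
  with (r * r * (Rsqr (sin th) + Rsqr (cos th))) by (unfold Rsqr; ring).
rewrite sin2_cos2, Rmult_1_r. now apply sqrt_square.
Qed.

Lemma continuous_polar (r th : R) : ccontinuous (polar r) th.
Proof.
apply continuous_C_pair;
  apply (ex_derive_continuous (K := R_AbsRing) (V := R_NormedModule)); auto_derive; auto.
Qed.

Lemma continuous_dpolar (r th : R) : ccontinuous (dpolar r) th.
Proof.
apply continuous_C_pair;
  apply (ex_derive_continuous (K := R_AbsRing) (V := R_NormedModule)); auto_derive; auto.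
Qed.

Lemma sin_le_abs (x : R) : Rabs (sin x) <= Rabs x.
Proof.
destruct (MVT_gen sin 0 x cos) as [c [_ Hc]].
- intros; apply is_derive_Reals, derivable_pt_lim_sin.
- intros; apply derivable_continuous_pt, derivable_pt_sin.
- rewrite sin_0, !Rminus_0_r in Hc. rewrite Hc, Rabs_mult.
  pose proof (COS_bound c). pose proof (Rabs_pos x).
  assert (Rabs (cos c) <= 1) by (apply Rabs_le; lra). nra.
Qed.

Lemma polar_lipschitz (r s t : R) : 0 <= r ->
  Cmod (polar r s - polar r t)%C <= r * Rabs (s - t).
Proof.
intros Hr.
(* The chord length, by the half-angle formula. *)
assert (E : Cmod (polar r s - polar r t)%C ^ 2 = (r * (2 * sin ((s - t) / 2))) ^ 2).
{ rewrite Cmod2_alt. unfold polar; simpl.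
  pose proof (sin2_cos2 s) as Es; pose proof (sin2_cos2 t) as Et; unfold Rsqr in *.
  assert (H : cos (s - t) = 1 - 2 * sin ((s - t) / 2) * sin ((s - t) / 2)).
  { replace (s - t) with (2 * ((s - t) / 2)) at 1 by field. rewrite cos_2a_sin; ring. }
  rewrite cos_minus in H.
  transitivity (r * r * ((sin s * sin s + cos s * cos s) + (sin t * sin t + cos t * cos t)
     - 2 * (cos s * cos t + sin s * sin t))); [ring|].
  rewrite Es, Et, H; ring. }
rewrite <- (Rabs_pos_eq (Cmod _)) by apply Cmod_ge_0.
rewrite <- !Rsqr_pow2 in E. apply Rsqr_eq_abs_0 in E. rewrite E.
rewrite Rabs_mult, (Rabs_pos_eq r), Rabs_mult, (Rabs_pos_eq 2) by lra.
pose proof (sin_le_abs ((s - t) / 2)) as H. unfold Rdiv in H at 2.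
rewrite Rabs_mult, (Rabs_pos_eq (/ 2)) in H by lra.
apply Rmult_le_compat_l; lra.
Qed.

(** The integrand q z + p has the explicit primitive p z + q z^2 / 2. Goursat's argument needs a
    primitive for affine functions only, since it subtracts the first-order expansion. *)
Lemma CInt_affine_path (p q : C) (X Y dX dY : R -> R) (a b : R) :
  (forall t, is_derive X t (dX t)) -> (forall t, is_derive Y t (dY t)) ->
  (forall t, continuous dX t) -> (forall t, continuous dY t) ->
  CInt (fun t => (q * (X t, Y t) + p) * (dX t, dY t))%C a b =
  ((p * (X b, Y b) + q * (X b, Y b) * (X b, Y b) * RtoC (/ 2)) -
   (p * (X a, Y a) + q * (X a, Y a) * (X a, Y a) * RtoC (/ 2)))%C.
Proof.
intros HX HY cX cY. destruct p as [p1 p2], q as [q1 q2].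
assert (kX : forall t, ccontinuous (fun s => (X s, Y s)) t).
{ intros t; apply continuous_C_pair;
  apply (ex_derive_continuous (K := R_AbsRing) (V := R_NormedModule)); eexists; eauto. }
set (g := fun t => (((q1, q2) * (X t, Y t) + (p1, p2)) * (dX t, dY t))%C).
assert (cg : forall t, ccontinuous g t).
{ intros t. apply continuous_C_mult; [|now apply continuous_C_pair].
  apply (continuous_cderiv_comp (fun z => (q1, q2) * z + (p1, p2))%C _ t (q1, q2));
  [apply cderiv_affine|auto]. }
change (CInt (fun t => (fst (g t), snd (g t))) a b =
  (((p1, p2) * (X b, Y b) + (q1, q2) * (X b, Y b) * (X b, Y b) * RtoC (/ 2)) -
   ((p1, p2) * (X a, Y a) + (q1, q2) * (X a, Y a) * (X a, Y a) * RtoC (/ 2)))%C).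
rewrite (CInt_derive
  (fun t => p1 * X t - p2 * Y t + (q1 * (X t * X t - Y t * Y t) - q2 * (2 * X t * Y t)) / 2)
  (fun t => p1 * Y t + p2 * X t + (q1 * (2 * X t * Y t) + q2 * (X t * X t - Y t * Y t)) / 2)).
- unfold Cminus, Cplus, Copp, Cmult, RtoC; simpl. f_equal; field.
- intros t; unfold g; simpl. auto_derive.
  + repeat split; eexists; eauto.
  + change (Derive (fun x : R => X x) t) with (Derive X t); change (Derive (fun x : R => Y x) t) with (Derive Y t).
    rewrite (is_derive_unique X t _ (HX t)), (is_derive_unique Y t _ (HY t)). field.
- intros t; unfold g; simpl. auto_derive.
  + repeat split; eexists; eauto.
  + change (Derive (fun x : R => X x) t) with (Derive X t); change (Derive (fun x : R => Y x) t) with (Derive Y t).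
    rewrite (is_derive_unique X t _ (HX t)), (is_derive_unique Y t _ (HY t)). field.
- intros t; apply (continuous_C_Re _ _ (cg t)).
- intros t; apply (continuous_C_Re _ _ (cg t)).
Qed.

Section Goursat.

Variables (c : C) (r : R).
Hypothesis Hr : 0 <= r <= 1.
Hypothesis Hc : Cmod c <= 1.

(* The homotopy shrinking the circle of radius r to the point c. *)
Definition htpy (l th : R) : C := (c + RtoC l * (polar r th - c))%C.

(** The form F(z) dz pulls back along [htpy] to [U] dl + [V] dth, and [D] is its integral
    counterclockwise around a rectangle in the (l, th) plane. Bisecting in the parameter plane
    avoids cutting up the disk itself. *)
Let U (F : C -> C) (l th : R) : C := (F (htpy l th) * (polar r th - c))%C.
Let V (F : C -> C) (l th : R) : C := (F (htpy l th) * (RtoC l * dpolar r th))%C.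

Let D (F : C -> C) (x1 x2 y1 y2 : R) : C :=
  ((CInt (V F x2) y1 y2 - CInt (V F x1) y1 y2) -
   (CInt (fun x => U F x y2) x1 x2 - CInt (fun x => U F x y1) x1 x2))%C.

Lemma continuous_htpy_l l th : ccontinuous (fun x => htpy x th) l.
Proof.
unfold htpy. destruct c as [c1 c2]. unfold polar.
apply (continuous_ext (fun x => (c1 + x * (r * cos th - c1), c2 + x * (r * sin th - c2)))).
- intros x. unfold Cplus, Cmult, Cminus, Copp, RtoC; simpl. f_equal; ring.
- apply continuous_C_pair;
  apply (ex_derive_continuous (K := R_AbsRing) (V := R_NormedModule)); auto_derive; auto.
Qed.

Lemma continuous_htpy_th l th : ccontinuous (htpy l) th.
Proof.
unfold htpy. destruct c as [c1 c2]. unfold polar.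
apply (continuous_ext (fun x => (c1 + l * (r * cos x - c1), c2 + l * (r * sin x - c2)))).
- intros x. unfold Cplus, Cmult, Cminus, Copp, RtoC; simpl. f_equal; ring.
- apply continuous_C_pair;
  apply (ex_derive_continuous (K := R_AbsRing) (V := R_NormedModule)); auto_derive; auto.
Qed.

Lemma continuous_U F l th : (exists m, cderiv F (htpy l th) m) ->
  ccontinuous (fun x => U F x th) l.
Proof.
intros [m Hm]. unfold U.
apply continuous_C_mult.
- apply (continuous_cderiv_comp F (fun x => htpy x th) l m Hm), continuous_htpy_l.
- apply continuous_const.
Qed.

Lemma continuous_V F l th : (exists m, cderiv F (htpy l th) m) -> ccontinuous (V F l) th.
Proof.
intros [m Hm]. unfold V.
apply continuous_C_mult.
- apply (continuous_cderiv_comp F (htpy l) th m Hm), continuous_htpy_th.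
- apply continuous_C_mult; [apply continuous_const|apply continuous_dpolar].
Qed.

Let good (F : C -> C) x1 x2 y1 y2 : Prop := forall x y, x1 <= x <= x2 -> y1 <= y <= y2 ->
  exists m, cderiv F (htpy x y) m.

Lemma D_minus F G x1 x2 y1 y2 : x1 <= x2 -> y1 <= y2 ->
  good F x1 x2 y1 y2 -> good G x1 x2 y1 y2 ->
  D (fun z => F z - G z)%C x1 x2 y1 y2 = (D F x1 x2 y1 y2 - D G x1 x2 y1 y2)%C.
Proof.
intros Hx Hy HF HG. unfold D.
assert (EV : forall x, x1 <= x <= x2 -> CInt (V (fun z => F z - G z)%C x) y1 y2
  = (CInt (V F x) y1 y2 - CInt (V G x) y1 y2)%C).
{ intros x Hx'. rewrite <- CInt_minus; auto.
  - apply CInt_ext; auto. intros; unfold V; ring.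
  - intros; apply continuous_V, HF; lra.
  - intros; apply continuous_V, HG; lra. }
assert (EU : forall y, y1 <= y <= y2 -> CInt (fun x => U (fun z => F z - G z)%C x y) x1 x2
  = (CInt (fun x => U F x y) x1 x2 - CInt (fun x => U G x y) x1 x2)%C).
{ intros y Hy'. rewrite <- CInt_minus; auto.
  - apply CInt_ext; auto. intros; unfold U; ring.
  - intros; apply continuous_U, HF; lra.
  - intros; apply continuous_U, HG; lra. }
rewrite !EV, !EU by lra. ring.
Qed.

Lemma D_affine p q x1 x2 y1 y2 : D (fun z => q * z + p)%C x1 x2 y1 y2 = 0%C.
Proof.
pose (H := fun z : C => (p * z + q * z * z * RtoC (/ 2))%C).
assert (EV : forall x, CInt (V (fun z => q * z + p)%C x) y1 y2
  = (H (htpy x y2) - H (htpy x y1))%C).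
{ intros x. unfold V, H.
  rewrite (surjective_pairing (htpy x y2)), (surjective_pairing (htpy x y1)).
  rewrite <- (CInt_affine_path p q (fun y => fst (htpy x y)) (fun y => snd (htpy x y))
    (fun y => x * (- r * sin y)) (fun y => x * (r * cos y)) y1 y2).
  - apply (f_equal (fun g => CInt g y1 y2)), functional_extensionality; intros y.
    rewrite <- surjective_pairing. f_equal. unfold dpolar, Cmult, RtoC; simpl; f_equal; ring.
  - intros y; unfold htpy, polar; simpl; auto_derive; auto; ring.
  - intros y; unfold htpy, polar; simpl; auto_derive; auto; ring.
  - intros y; apply (ex_derive_continuous (K := R_AbsRing) (V := R_NormedModule)); auto_derive; auto.
  - intros y; apply (ex_derive_continuous (K := R_AbsRing) (V := R_NormedModule)); auto_derive; auto. }
assert (EU : forall y, CInt (fun x => U (fun z => q * z + p)%C x y) x1 x2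
  = (H (htpy x2 y) - H (htpy x1 y))%C).
{ intros y. unfold U, H.
  rewrite (surjective_pairing (htpy x2 y)), (surjective_pairing (htpy x1 y)).
  rewrite <- (CInt_affine_path p q (fun x => fst (htpy x y)) (fun x => snd (htpy x y))
    (fun _ => fst (polar r y - c)%C) (fun _ => snd (polar r y - c)%C) x1 x2).
  - apply (f_equal (fun g => CInt g x1 x2)), functional_extensionality; intros x. now rewrite <- !surjective_pairing.
  - intros x; unfold htpy, polar; simpl; auto_derive; auto; ring.
  - intros x; unfold htpy, polar; simpl; auto_derive; auto; ring.
  - intros x; apply continuous_const.
  - intros x; apply continuous_const. }
unfold D. rewrite !EV, !EU. ring.
Qed.

(** The speed of [htpy] is at most r + |c| <= 2 in l and at most l r <= 1 in th; each direction
    contributes two sides. *)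
Lemma D_bound G m x1 x2 y1 y2 : 0 <= x1 -> x1 <= x2 -> x2 <= 1 -> y1 <= y2 ->
  good G x1 x2 y1 y2 ->
  (forall x y, x1 <= x <= x2 -> y1 <= y <= y2 -> Cmod (G (htpy x y)) <= m) ->
  Cmod (D G x1 x2 y1 y2) <= 2 * m * (2 * (x2 - x1) + (y2 - y1)).
Proof.
intros H0 Hx H1 Hy HG Hm. unfold D.
assert (BV : forall x, x1 <= x <= x2 -> Cmod (CInt (V G x) y1 y2) <= (y2 - y1) * m).
{ intros x Hx'. apply CInt_bound; auto.
  - intros; apply continuous_V, HG; lra.
  - intros y Hy'; unfold V. rewrite !Cmod_mult, Cmod_R, Cmod_dpolar, Rabs_pos_eq by lra.
    pose proof (Hm x y Hx' Hy'). pose proof (Cmod_ge_0 (G (htpy x y))).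
    assert (0 <= x * r <= 1) by nra. nra. }
assert (BU : forall y, y1 <= y <= y2 -> Cmod (CInt (fun x => U G x y) x1 x2) <= (x2 - x1) * (m * 2)).
{ intros y Hy'. apply CInt_bound; auto.
  - intros; apply continuous_U, HG; lra.
  - intros x Hx'; unfold U. rewrite Cmod_mult.
    pose proof (Hm x y Hx' Hy'). pose proof (Cmod_ge_0 (G (htpy x y))).
    pose proof (Cmod_sub_le (polar r y) c) as Hs. rewrite Cmod_polar in Hs by lra.
    pose proof (Cmod_ge_0 (polar r y - c)%C). nra. }
pose proof (BV x1 ltac:(lra)); pose proof (BV x2 ltac:(lra)).
pose proof (BU y1 ltac:(lra)); pose proof (BU y2 ltac:(lra)).
eapply Rle_trans; [apply Cmod_sub_le|].
eapply Rle_trans; [apply Rplus_le_compat; apply Cmod_sub_le|]. lra.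
Qed.

Lemma htpy_lipschitz x y x' y' : 0 <= x' <= 1 ->
  Cmod (htpy x y - htpy x' y')%C <= 2 * Rabs (x - x') + Rabs (y - y').
Proof.
intros Hx'.
replace (htpy x y - htpy x' y')%C with
  (RtoC (x - x') * (polar r y - c) + RtoC x' * (polar r y - polar r y'))%C
  by (unfold htpy; rewrite RtoC_minus; ring).
eapply Rle_trans; [apply Cmod_triangle|]. rewrite !Cmod_mult, !Cmod_R.
rewrite (Rabs_pos_eq x') by lra.
pose proof (polar_lipschitz r y y' (proj1 Hr)).
pose proof (Cmod_sub_le (polar r y) c) as H1. rewrite Cmod_polar in H1 by lra.
pose proof (Rabs_pos (x - x')). pose proof (Rabs_pos (y - y')).
pose proof (Cmod_ge_0 (polar r y - polar r y')%C).
apply Rplus_le_compat; nra.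
Qed.

(** Stopping the homotopy at [x0] allows [F] to be singular at [c], as the Cauchy integrand is. The
    sides th = 0 and th = 2 PI cancel by periodicity, so only the two circles remain. *)
Theorem goursat F x0 : 0 <= x0 <= 1 -> (forall x y, x0 <= x <= 1 -> exists m, cderiv F (htpy x y) m) ->
  CInt (V F x0) 0 (2 * PI) = CInt (V F 1) 0 (2 * PI).
Proof.
intros Hx0 HF. pose proof PI_RGT_0 as Hpi.
assert (HD : D F x0 (x0 + (1 - x0)) 0 (0 + 2 * PI) = 0%C).
{ apply rectangle_bisection; try lra.
  - intros x y a b Ha Hb H1 H2 H3 H4. unfold D.
    replace (x + a + a) with (x + 2 * a) by ring. replace (y + b + b) with (y + 2 * b) by ring.
    assert (EV : forall x', x <= x' <= x + 2 * a -> CInt (V F x') y (y + 2 * b) =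
      (CInt (V F x') y (y + b) + CInt (V F x') (y + b) (y + 2 * b))%C).
    { intros x' Hx'. apply CInt_Chasles; try lra. intros; apply continuous_V, HF; lra. }
    assert (EU : forall y', CInt (fun x => U F x y') x (x + 2 * a) =
      (CInt (fun x => U F x y') x (x + a) + CInt (fun x => U F x y') (x + a) (x + 2 * a))%C).
    { intros y'. apply CInt_Chasles; try lra. intros; apply continuous_U, HF; lra. }
    rewrite !EV, !EU by lra. ring.
  - intros x y Hx Hy eps Heps.
    destruct (HF x y ltac:(lra)) as [m Hm].
    set (L := 2 * (1 - x0) + 2 * PI). assert (HL : 0 < L) by (unfold L; lra).
    assert (HL2 : 0 < 2 * L * L) by nra.
    (* At scale s, points of the image lie within s L of [z0] and [D_bound] contributes the factor 2
       s L; the product of these with this constant is eps s^2. *)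
    destruct (Hm (eps / (2 * L * L))) as [d [Hd Hdm]]; [now apply Rdiv_lt_0_compat|].
    exists (d / L); split; [now apply Rdiv_lt_0_compat|].
    intros x' y' s [Hs0 Hs] K1 K2 K3 K4 K5 K6.
    assert (Hsl : s * L < d).
    { apply (Rmult_lt_compat_r L) in Hs; auto. unfold Rdiv in Hs.
      rewrite Rmult_assoc, Rinv_l, Rmult_1_r in Hs; lra. }
    set (z0 := htpy x y) in *.
    set (aff := fun z => (m * z + (F z0 - m * z0))%C).
    set (e := fun z => (F z - aff z)%C).
    assert (HsA : 0 <= s * (1 - x0)) by (apply Rmult_le_pos; lra).
    assert (HsB : 0 <= s * (2 * PI)) by (apply Rmult_le_pos; lra).
    assert (GF : good F x' (x' + s * (1 - x0)) y' (y' + s * (2 * PI)))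
      by (intros u v Hu Hv; apply HF; lra).
    assert (GA : good aff x' (x' + s * (1 - x0)) y' (y' + s * (2 * PI)))
      by (intros u v Hu Hv; exists m; apply cderiv_affine).
    assert (Ge : good e x' (x' + s * (1 - x0)) y' (y' + s * (2 * PI))).
    { intros u v Hu Hv. destruct (GF u v Hu Hv) as [m1 H1]; destruct (GA u v Hu Hv) as [m2 H2].
      eexists; apply cderiv_minus; eauto. }
    replace (D F x' (x' + s * (1 - x0)) y' (y' + s * (2 * PI))) with
      (D e x' (x' + s * (1 - x0)) y' (y' + s * (2 * PI))).
    2:{ unfold e; rewrite D_minus; auto; try lra.
        unfold aff; rewrite D_affine. ring. }
    eapply Rle_trans.
    + apply (D_bound e (eps / (2 * L * L) * (s * L))); auto; try lra.
      intros u v Hu Hv.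
      assert (Hz : Cmod (htpy u v - z0)%C <= s * L).
      { eapply Rle_trans; [apply htpy_lipschitz; lra|].
        assert (Rabs (u - x) <= s * (1 - x0)) by (apply Rabs_le; lra).
        assert (Rabs (v - y) <= s * (2 * PI)) by (apply Rabs_le; lra).
        unfold L; lra. }
      specialize (Hdm (htpy u v) ltac:(lra)).
      replace (e (htpy u v)) with (F (htpy u v) - F z0 - m * (htpy u v - z0))%C
        by (unfold e, aff; ring).
      eapply Rle_trans; [exact Hdm|]. apply Rmult_le_compat_l; [|exact Hz].
      left; now apply Rdiv_lt_0_compat.
    + right. unfold L. field. unfold L in HL; lra. }
unfold D in HD.
replace (x0 + (1 - x0)) with 1 in HD by ring. rewrite Rplus_0_l in HD.
assert (EU : CInt (fun x => U F x (2 * PI)) x0 1 = CInt (fun x => U F x 0) x0 1).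
{ apply CInt_ext; [lra|]. intros x _. unfold U, htpy, polar.
  now rewrite cos_2PI, sin_2PI, cos_0, sin_0. }
rewrite EU in HD.
symmetry; apply Ceq_minus. rewrite <- HD; ring.
Qed.

End Goursat.

(** * Cauchy's estimate and the mean value property *)

Definition ckernel (c : C) (r th : R) : C := (dpolar r th / (polar r th - c))%C.

Lemma dpolar_eq (r th : R) : dpolar r th = (Ci * polar r th)%C.
Proof. unfold dpolar, polar, Ci, Cmult; simpl; f_equal; ring. Qed.

Lemma polar_minus_lower (c : C) (r th : R) : 0 <= r ->
  r - Cmod c <= Cmod (polar r th - c)%C.
Proof.
intros Hr. pose proof (Cmod_triangle_inv (polar r th) c) as H.
rewrite Cmod_polar in H; auto.
Qed.

Lemma polar_minus_neq0 (c : C) (r th : R) : Cmod c < r -> (polar r th - c)%C <> 0%C.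
Proof.
intros Hc. pose proof (Cmod_ge_0 c).
apply Cmod_gt_0. pose proof (polar_minus_lower c r th). lra.
Qed.

Lemma continuous_ckernel (c : C) (r th : R) : Cmod c < r -> ccontinuous (ckernel c r) th.
Proof.
intros Hc. unfold ckernel, Cdiv. apply continuous_C_mult; [apply continuous_dpolar|].
eapply (continuous_cderiv_comp (fun w => / w)%C (fun t => polar r t - c)%C th).
- apply cderiv_inv. now apply polar_minus_neq0.
- apply (continuous_ext (fun t => 1 * polar r t + - c)%C); [intros t; change ((1 * polar r t + - c)%C = (polar r t - c)%C); ring|].
  apply (continuous_cderiv_comp (fun w => 1 * w + - c)%C (polar r) th 1%C).
  + apply cderiv_affine.
  + apply continuous_polar.
Qed.

Lemma Cmod_ckernel_le (c : C) (r th : R) : Cmod c < r -> r <= 1 ->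
  Cmod (ckernel c r th) <= / (r - Cmod c).
Proof.
intros Hc Hr. pose proof (Cmod_ge_0 c).
unfold ckernel. rewrite Cmod_div by now apply polar_minus_neq0.
rewrite Cmod_dpolar by lra.
pose proof (polar_minus_lower c r th ltac:(lra)).
unfold Rdiv. rewrite <- (Rmult_1_l (/ (r - Cmod c))).
apply Rmult_le_compat; try lra.
- left; apply Rinv_0_lt_compat; lra.
- apply Rinv_le_contravar; lra.
Qed.

(** With w = [polar r th] the kernel is i w / (w - c), so its imaginary part is Re (w / (w - c)),
    and 2 Re (w / (w - c)) - 1 = (|w|^2 - |c|^2) / |w - c|^2 is positive. This bounds the integral
    of the kernel from below without computing its value 2 PI i. *)
Lemma im_ckernel_ge (c : C) (r th : R) : Cmod c < r -> / 2 <= snd (ckernel c r th).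
Proof.
intros Hc. pose proof (Cmod_ge_0 c) as H0.
pose proof (polar_minus_neq0 c r th Hc) as Hne.
apply Cmod_gt_0 in Hne. pose proof (pow_lt _ 2 Hne) as Hp. rewrite Cmod2_alt in Hp.
assert (Hcr : Cmod c ^ 2 < r ^ 2) by (simpl; nra).
rewrite Cmod2_alt in Hcr.
unfold ckernel, Cdiv. destruct c as [c1 c2]. unfold dpolar, polar in *; simpl in *.
set (u := r * cos th) in *. set (v := r * sin th) in *.
assert (Euv : u * u + v * v = r * r).
{ unfold u, v. pose proof (sin2_cos2 th) as E; unfold Rsqr in E.
  transitivity (r * r * (sin th * sin th + cos th * cos th)); [ring|rewrite E; ring]. }
replace (- r * sin th) with (- v) by (unfold v; ring).
match goal with |- / 2 <= ?X => replace X with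
  ((v * (v - c2) + u * (u - c1)) / ((u - c1) ^ 2 + (v - c2) ^ 2)) end.
2:{ field. simpl; unfold Rminus. lra. }
apply (Rmult_le_reg_r ((u - c1) ^ 2 + (v - c2) ^ 2)); [simpl; unfold Rminus; lra|].
unfold Rdiv at 1. rewrite Rmult_assoc, Rinv_l, Rmult_1_r by (simpl; unfold Rminus; lra).
simpl; nra.
Qed.

Lemma CInt_im (g : R -> C) (a b : R) : a <= b ->
  (forall x, a <= x <= b -> ccontinuous g x) ->
  snd (CInt g a b) = RInt (fun x => snd (g x)) a b.
Proof.
intros Hab Hg.
apply ex_CInt in Hg; auto.
destruct Hg as [l Hl].
assert (E : CInt g a b = l) by exact (is_RInt_unique (V := C_R_CompleteNormedModule) _ _ _ _ Hl).
rewrite E. symmetry.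
apply (is_RInt_unique (V := R_CompleteNormedModule)).
destruct l as [l1 l2].
apply (is_RInt_fct_extend_snd (U := R_NormedModule) (V := R_NormedModule) g a b (l1, l2) Hl).
Qed.

Lemma CInt_mult_l (k : C) (g : R -> C) (a b : R) : a <= b ->
  (forall x, a <= x <= b -> ccontinuous g x) ->
  CInt (fun x => k * g x)%C a b = (k * CInt g a b)%C.
Proof.
intros Hab Hg.
assert (H1 : ex_RInt (fun x => fst (g x)) a b).
{ apply (ex_RInt_continuous (V := R_CompleteNormedModule)); intros x Hx.
  rewrite Rmin_left, Rmax_right in Hx by lra. apply (continuous_C_Re g x (Hg x Hx)). }
assert (H2 : ex_RInt (fun x => snd (g x)) a b).
{ apply (ex_RInt_continuous (V := R_CompleteNormedModule)); intros x Hx.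
  rewrite Rmin_left, Rmax_right in Hx by lra. apply (continuous_C_Re g x (Hg x Hx)). }
assert (Hk : forall x, a <= x <= b -> ccontinuous (fun x => k * g x)%C x)
  by (intros x Hx; apply continuous_C_mult; [apply continuous_const|auto]).
assert (Hs : forall (u : R -> R) l, ex_RInt u a b -> ex_RInt (fun x => l * u x) a b)
  by (intros u l Hu; exact (ex_RInt_scal (V := R_NormedModule) u a b l Hu)).
assert (Es : forall (u : R -> R) l, ex_RInt u a b -> RInt (fun x => l * u x) a b = l * RInt u a b)
  by (intros u l Hu; exact (RInt_scal (V := R_CompleteNormedModule) u a b l Hu)).
pose proof (CInt_re g a b Hab Hg) as E1; pose proof (CInt_im g a b Hab Hg) as E2.
apply injective_projections; [rewrite CInt_re by auto|rewrite CInt_im by auto];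
  destruct (CInt g a b) as [G1 G2]; simpl in E1, E2; subst G1 G2.
- destruct k as [k1 k2]; simpl.
  rewrite <- !Es by auto.
  exact (RInt_minus (V := R_CompleteNormedModule) (fun x => k1 * fst (g x)) (fun x => k2 * snd (g x)) a b (Hs _ _ H1) (Hs _ _ H2)).
- destruct k as [k1 k2]; simpl.
  rewrite <- !Es by auto.
  exact (RInt_plus (V := R_CompleteNormedModule) (fun x => k1 * snd (g x)) (fun x => k2 * fst (g x)) a b (Hs _ _ H2) (Hs _ _ H1)).
Qed.

Lemma Cmod_CInt_ckernel_ge (c : C) (r : R) : Cmod c < r ->
  PI <= Cmod (CInt (ckernel c r) 0 (2 * PI)).
Proof.
intros Hc. pose proof PI_RGT_0 as Hpi.
eapply Rle_trans; [|eapply Rle_trans; [apply Rmax_r|apply Rmax_Cmod]].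
eapply Rle_trans; [|apply Rle_abs].
rewrite CInt_im; [|lra|intros; now apply continuous_ckernel].
assert (E : RInt (fun _ : R => / 2) 0 (2 * PI) = PI).
{ rewrite RInt_const. change ((2 * PI - 0) * / 2 = PI). field. }
rewrite <- E at 1.
apply RInt_le; [lra| | |].
- apply ex_RInt_const.
- apply (ex_RInt_continuous (V := R_CompleteNormedModule)); intros.
  apply (continuous_C_Re (ckernel c r)). now apply continuous_ckernel.
- intros; now apply im_ckernel_ge.
Qed.

Lemma htpy_in_disk (c : C) (r l th : R) : Cmod c < r -> r < 1 -> 0 <= l <= 1 ->
  in_disk (htpy c r l th).
Proof.
intros Hc Hr Hl. pose proof (Cmod_ge_0 c). unfold in_disk, htpy.
replace (c + l * (polar r th - c))%C with (RtoC (1 - l) * c + RtoC l * polar r th)%C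
  by (rewrite RtoC_minus; ring).
eapply Rle_lt_trans; [apply Cmod_triangle|].
rewrite !Cmod_mult, !Cmod_R, Cmod_polar, !Rabs_pos_eq by lra. nra.
Qed.

Lemma analytic_cderiv (h : C -> C) (z : C) : analytic_on_disk h -> in_disk z ->
  exists l, cderiv h z l.
Proof. intros Hh Hz; apply ex_derive_cderiv; auto. Qed.

(** By [goursat] applied to h(z) / (z - c), the left side is unchanged when the circle is shrunk by
    any factor l > 0; the factor l cancels in dz / (z - c), so only the argument of [h] depends on
    l, and it tends to [c]. *)
Theorem cauchy_circle (h : C -> C) (c : C) (r : R) : analytic_on_disk h ->
  Cmod c < r -> r < 1 ->
  CInt (fun th => h (polar r th) * ckernel c r th)%C 0 (2 * PI) =
  (h c * CInt (ckernel c r) 0 (2 * PI))%C.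
Proof.
intros Hh Hc Hr. pose proof PI_RGT_0 as Hpi. pose proof (Cmod_ge_0 c) as Hc0.
set (J := fun l => CInt (fun th => h (htpy c r l th) * ckernel c r th)%C 0 (2 * PI)).
assert (HJ : forall l, 0 < l <= 1 -> J l = J 1).
{ intros l Hl. unfold J.
  pose proof (goursat c r ltac:(lra) ltac:(lra) (fun z => h z * / (z - c))%C l ltac:(lra)) as G.
  rewrite (CInt_ext (fun th => h (htpy c r l th) * ckernel c r th)%C
    (fun th => h (htpy c r l th) * / (htpy c r l th - c) * (RtoC l * dpolar r th))%C).
  rewrite (CInt_ext (fun th => h (htpy c r 1 th) * ckernel c r th)%C
    (fun th => h (htpy c r 1 th) * / (htpy c r 1 th - c) * (RtoC 1 * dpolar r th))%C).
  - apply G. intros x y Hx.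
    destruct (analytic_cderiv h (htpy c r x y) Hh) as [m Hm]; [apply htpy_in_disk; lra|].
    assert (Hn : (htpy c r x y - c)%C <> 0%C).
    { unfold htpy. replace (c + x * (polar r y - c) - c)%C with (x * (polar r y - c))%C by ring.
      apply Cmult_neq_0; [|now apply polar_minus_neq0].
      intros E; apply RtoC_inj in E; lra. }
    eexists. apply cderiv_mult; [exact Hm|].
    apply (cderiv_comp (fun w => / w)%C (fun z => z - c)%C).
    + now apply cderiv_inv.
    + intros eps Heps. destruct (cderiv_affine 1 (- c)%C (htpy c r x y) eps Heps) as [d [Hd H]].
      exists d; split; auto. intros w Hw; specialize (H w Hw).
      replace (w - c - (htpy c r x y - c) - 1 * (w - htpy c r x y))%C with
       (1 * w + - c - (1 * htpy c r x y + - c) - 1 * (w - htpy c r x y))%C by ring. exact H.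
  - lra.
  - intros th _. unfold ckernel.
    replace (htpy c r 1 th - c)%C with (polar r th - c)%C by (unfold htpy; ring).
    field. now apply polar_minus_neq0.
  - lra.
  - intros th _. unfold ckernel.
    replace (htpy c r l th - c)%C with (RtoC l * (polar r th - c))%C by (unfold htpy; ring).
    field. split; [now apply polar_minus_neq0|].
    intros E; apply RtoC_inj in E; lra. }
assert (EJ : CInt (fun th => h (polar r th) * ckernel c r th)%C 0 (2 * PI) = J 1).
{ unfold J. apply CInt_ext; [lra|]. intros th _. 
  now replace (htpy c r 1 th) with (polar r th) by (unfold htpy; ring). }
rewrite EJ. apply Ceq_minus, Cmod_eq_0, Rle_antisym; [|apply Cmod_ge_0].
apply le_epsilon; intros eps Heps. rewrite Rplus_0_l.
(* Integrating e / (r - |c|) over the circle gives eps. Below, l <= d / 3 suffices because |polar r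
   th - c| < 2. *)
set (e := eps * (r - Cmod c) / (2 * PI)).
assert (He : 0 < e) by (apply Rdiv_lt_0_compat; [apply Rmult_lt_0_compat|]; lra).
destruct (analytic_cderiv h c Hh) as [m Hm]; [unfold in_disk; lra|].
destruct (cderiv_cont h c m Hm e He) as [d [Hd Hd']].
set (l := Rmin 1 (d / 3)).
assert (Hl : 0 < l <= 1) by (unfold l; split; [apply Rmin_glb_lt; lra|apply Rmin_l]).
assert (Hld : l <= d / 3) by apply Rmin_r.
rewrite <- (HJ l Hl).
replace (h c * CInt (ckernel c r) 0 (2 * PI))%C with (CInt (fun th => h c * ckernel c r th)%C 0 (2 * PI)).
2:{ apply CInt_mult_l; [lra|intros; now apply continuous_ckernel]. }
assert (K1 : forall th, ccontinuous (fun th => h (htpy c r l th) * ckernel c r th)%C th).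
{ intros th. apply continuous_C_mult; [|now apply continuous_ckernel].
  destruct (analytic_cderiv h (htpy c r l th) Hh) as [m' Hm']; [apply htpy_in_disk; lra|].
  apply (continuous_cderiv_comp h (htpy c r l) th m' Hm'), continuous_htpy_th; lra. }
assert (K2 : forall th, ccontinuous (fun th => h c * ckernel c r th)%C th).
{ intros th. apply continuous_C_mult; [apply continuous_const|now apply continuous_ckernel]. }
unfold J. rewrite <- CInt_minus.
- replace eps with ((2 * PI - 0) * (e * / (r - Cmod c))) by (unfold e; field; lra).
  apply CInt_bound; [lra| |].
  + intros th _. apply (continuous_minus (V := C_R_NormedModule)); auto.
  + intros th _.
    replace (h (htpy c r l th) * ckernel c r th - h c * ckernel c r th)%C with
      ((h (htpy c r l th) - h c) * ckernel c r th)%C by ring.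
    rewrite Cmod_mult. apply Rmult_le_compat; try apply Cmod_ge_0.
    * left. apply Hd'. unfold htpy.
      replace (c + l * (polar r th - c) - c)%C with (l * (polar r th - c))%C by ring.
      rewrite Cmod_mult, Cmod_R, Rabs_pos_eq by lra.
      pose proof (Cmod_sub_le (polar r th) c) as H. rewrite Cmod_polar in H by lra. nra.
    * apply Cmod_ckernel_le; lra.
- lra.
- auto.
- auto.
Qed.

Lemma continuous_analytic_polar (h : C -> C) (r th : R) : analytic_on_disk h -> 0 <= r < 1 ->
  ccontinuous (fun t => h (polar r t)) th.
Proof.
intros Hh Hr. destruct (analytic_cderiv h (polar r th) Hh) as [m Hm].
- unfold in_disk; rewrite Cmod_polar; lra.
- apply (continuous_cderiv_comp h (polar r) th m Hm), continuous_polar.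
Qed.

Theorem cauchy_estimate (h : C -> C) (c : C) (r : R) : analytic_on_disk h ->
  Cmod c < r -> r < 1 ->
  Cmod (h c) <= / (PI * (r - Cmod c)) * RInt (fun th => Cmod (h (polar r th))) 0 (2 * PI).
Proof.
intros Hh Hc Hr. pose proof PI_RGT_0 as Hpi. pose proof (Cmod_ge_0 c) as Hc0.
assert (cth : forall th, ccontinuous (fun t => h (polar r t)) th)
  by (intros; apply continuous_analytic_polar; auto; lra).
pose proof (cauchy_circle h c r Hh Hc Hr) as E.
apply (f_equal Cmod) in E. rewrite Cmod_mult in E.
pose proof (Cmod_CInt_ckernel_ge c r Hc) as HA.
assert (HB : Cmod (CInt (fun th => h (polar r th) * ckernel c r th)%C 0 (2 * PI)) <=
  / (r - Cmod c) * RInt (fun th => Cmod (h (polar r th))) 0 (2 * PI)).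
{ assert (ex : ex_RInt (fun th => Cmod (h (polar r th))) 0 (2 * PI)).
  { apply (ex_RInt_continuous (V := R_CompleteNormedModule)); intros. apply continuous_Cmod, cth. }
  pose proof (RInt_scal (V := R_CompleteNormedModule) (fun th => Cmod (h (polar r th))) 0 (2 * PI)
    (/ (r - Cmod c)) ex) as Es.
  change (scal (/ (r - Cmod c)) (RInt (fun th => Cmod (h (polar r th))) 0 (2 * PI))) with
    (/ (r - Cmod c) * RInt (fun th => Cmod (h (polar r th))) 0 (2 * PI)) in Es.
  rewrite <- Es; clear Es.
  assert (ck : forall th, ccontinuous (fun th => h (polar r th) * ckernel c r th)%C th)
    by (intros; apply continuous_C_mult; [apply cth|now apply continuous_ckernel]).
  eapply Rle_trans; [apply Cmod_CInt_le; [lra|auto]|].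
  apply RInt_le; [lra| | |].
  - apply (ex_RInt_continuous (V := R_CompleteNormedModule)); intros. now apply continuous_Cmod.
  - exact (ex_RInt_scal (V := R_NormedModule) _ 0 (2 * PI) (/ (r - Cmod c)) ex).
  - intros th _. rewrite Cmod_mult, Rmult_comm.
    apply Rmult_le_compat_r; [apply Cmod_ge_0|apply Cmod_ckernel_le; lra]. }
rewrite E in HB.
pose proof (Cmod_ge_0 (h c)).
apply (Rmult_le_reg_l PI); [lra|].
rewrite Rinv_mult, <- !Rmult_assoc, Rinv_r, Rmult_1_l by lra.
nra.
Qed.

(** For c = 0 the kernel is the constant i, which can be divided out. *)
Theorem mean_value (h : C -> C) (r : R) : analytic_on_disk h -> 0 < r < 1 ->
  CInt (fun th => h (polar r th)) 0 (2 * PI) = (RtoC (2 * PI) * h 0)%C.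
Proof.
intros Hh Hr. pose proof PI_RGT_0 as Hpi.
assert (Hk : forall th, ckernel 0 r th = Ci).
{ intros th. unfold ckernel. rewrite dpolar_eq. field.
  intros E. apply (f_equal Cmod) in E. rewrite Cmod_0, Cmod_polar in E; lra. }
pose proof (cauchy_circle h 0 r Hh) as E. rewrite Cmod_0 in E. specialize (E ltac:(lra) ltac:(lra)).
rewrite (CInt_ext (ckernel 0 r) (fun _ => Ci)), CInt_const in E; [|lra|auto].
rewrite (CInt_ext _ (fun th => Ci * h (polar r th))%C), CInt_mult_l in E;
  [|lra|intros; apply continuous_analytic_polar; auto; lra|lra|intros; rewrite Hk; ring].
replace (h 0 * ((2 * PI - 0)%R * Ci))%C with (Ci * ((2 * PI)%R * h 0))%C in E
  by (rewrite Rminus_0_r; ring).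
apply (f_equal (fun z => / Ci * z)%C) in E.
rewrite !Cmult_assoc, Cinv_l, !Cmult_1_l in E by apply Ci_nz. rewrite E; ring.
Qed.

(** * Real powers *)

Lemma Rpower_pos (x y : R) : 0 < Rpower x y.
Proof. apply exp_pos. Qed.

Lemma ln_Rpower (x y : R) : ln (Rpower x y) = y * ln x.
Proof. apply ln_exp. Qed.

(** Estimates between products of real powers are proved after taking logarithms, where exponents
    become coefficients and only arithmetic in the logarithms of the bases remains. *)
Ltac ln_pos := unfold Rdiv; repeat first [ assumption | lra | apply Rpower_pos
  | apply Rinv_0_lt_compat | apply Rmult_lt_0_compat ].

Ltac ln_expand := unfold Rdiv;
  repeat first [ rewrite ln_mult by ln_pos | rewrite ln_Rpower | rewrite ln_Rinv by ln_pos ].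

Lemma ln_le_cancel (x y : R) : 0 < x -> 0 < y -> ln x <= ln y -> x <= y.
Proof.
intros Hx Hy [H|H]; [left; now apply ln_lt_inv|right; now apply ln_inv].
Qed.

Lemma Rpower_le_l (x y z : R) : 0 < x -> x <= y -> 0 <= z -> Rpower x z <= Rpower y z.
Proof. intros Hx Hxy Hz. apply Rle_Rpower_l; lra. Qed.

Lemma rpow_pos_eq (x y : R) : 0 < x -> rpow x y = Rpower x y.
Proof. intros Hx; unfold rpow; destruct (Rle_dec x 0); [lra|auto]. Qed.

Lemma rpow_0 (y : R) : rpow 0 y = 0.
Proof. unfold rpow; destruct (Rle_dec 0 0); [auto|lra]. Qed.

Lemma rpow_ge0 (x y : R) : 0 <= rpow x y.
Proof. unfold rpow; destruct (Rle_dec x 0); [lra|left; apply Rpower_pos]. Qed.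

Lemma rpow_le (x y q : R) : 0 < q -> x <= y -> rpow x q <= rpow y q.
Proof.
intros Hq Hxy. destruct (Rle_dec x 0) as [H|H].
- unfold rpow at 1; destruct (Rle_dec x 0); [apply rpow_ge0|lra].
- rewrite !rpow_pos_eq by lra. apply Rpower_le_l; lra.
Qed.

Lemma continuous_rpow (q x : R) : 0 < q -> continuous (fun t => rpow t q) x.
Proof.
intros Hq. destruct (total_order_T x 0) as [[Hx|Hx]|Hx].
- apply (continuous_ext_loc _ (fun _ => 0)).
  + exists (mkposreal (- x) ltac:(lra)); intros y Hy.
    apply Rabs_lt_between in Hy; simpl in Hy.
    unfold minus, plus, opp in Hy; simpl in Hy.
    unfold rpow; destruct (Rle_dec y 0); auto; lra.
  + apply continuous_const.
(* At 0 continuity rests on the convention 0^q = 0; the radius is eps^(1/q). *)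
- subst x. apply filterlim_locally; intros [eps Heps].
  exists (mkposreal (Rpower eps (/ q)) (Rpower_pos _ _)); intros y Hy.
  change (Rabs (rpow y q - rpow 0 q) < eps). change (Rabs (y - 0) < Rpower eps (/ q)) in Hy.
  rewrite rpow_0, Rminus_0_r, Rabs_pos_eq by apply rpow_ge0.
  rewrite Rminus_0_r in Hy. unfold rpow; destruct (Rle_dec y 0); auto.
  rewrite Rabs_pos_eq in Hy by lra.
  apply ln_lt_inv; [apply Rpower_pos|auto|].
  apply ln_increasing in Hy; [|lra]. rewrite ln_Rpower in *.
  apply (Rmult_lt_compat_l q) in Hy; auto.
  rewrite <- Rmult_assoc, Rinv_r, Rmult_1_l in Hy; lra.
- apply (continuous_ext_loc _ (fun t => Rpower t q)).
  + exists (mkposreal x Hx); intros y Hy.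
    apply Rabs_lt_between in Hy; simpl in Hy.
    unfold minus, plus, opp in Hy; simpl in Hy.
    rewrite rpow_pos_eq; auto; lra.
  + unfold Rpower. apply (ex_derive_continuous (K := R_AbsRing) (V := R_NormedModule)).
    auto_derive; lra.
Qed.

Lemma continuous_rpow_polar (h : C -> C) (r q th : R) : analytic_on_disk h -> 0 <= r < 1 -> 0 < q ->
  continuous (fun t => rpow (Cmod (h (polar r t))) q) th.
Proof.
intros Hh Hr Hq.
apply (continuous_comp (fun t => Cmod (h (polar r t))) (fun x => rpow x q)).
- apply continuous_Cmod, continuous_analytic_polar; auto.
- now apply continuous_rpow.
Qed.

Lemma ex_RInt_rpow_polar (h : C -> C) (r q : R) : analytic_on_disk h -> 0 <= r < 1 -> 0 < q ->
  ex_RInt (fun t => rpow (Cmod (h (polar r t))) q) 0 (2 * PI).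
Proof.
intros. apply (ex_RInt_continuous (V := R_CompleteNormedModule)); intros.
now apply continuous_rpow_polar.
Qed.

Lemma RInt_Rmult_l (k : R) (g : R -> R) (a b : R) : ex_RInt g a b ->
  RInt (fun x => k * g x) a b = k * RInt g a b.
Proof. intros H; exact (RInt_scal (V := R_CompleteNormedModule) g a b k H). Qed.

Lemma ex_RInt_Rmult_l (k : R) (g : R -> R) (a b : R) : ex_RInt g a b ->
  ex_RInt (fun x => k * g x) a b.
Proof. intros H; exact (ex_RInt_scal (V := R_NormedModule) g a b k H). Qed.

Lemma RInt_Rplus (f g : R -> R) (a b : R) : ex_RInt f a b -> ex_RInt g a b ->
  RInt (fun x => f x + g x) a b = RInt f a b + RInt g a b.
Proof. intros Hf Hg; exact (RInt_plus (V := R_CompleteNormedModule) f g a b Hf Hg). Qed.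

Lemma RInt_Rminus (f g : R -> R) (a b : R) : ex_RInt f a b -> ex_RInt g a b ->
  RInt (fun x => f x - g x) a b = RInt f a b - RInt g a b.
Proof. intros Hf Hg; exact (RInt_minus (V := R_CompleteNormedModule) f g a b Hf Hg). Qed.

Lemma RInt_Rconst (k a b : R) : RInt (fun _ => k) a b = (b - a) * k.
Proof. exact (RInt_const (V := R_CompleteNormedModule) a b k). Qed.

(* Hardy-Littlewood: for s <= 1, split |G| = |G|^(1-s) |G|^s in the Cauchy
   estimate and absorb the weighted supremum of |G| in itself. *)
Lemma sup_bound_small_exponent (G : C -> C) (s rho W : R) : analytic_on_disk G ->
  0 < s <= 1 -> 0 < rho < 1 -> 0 < W ->
  (forall r, 0 <= r < rho -> RInt (fun t => rpow (Cmod (G (polar r t))) s) 0 (2 * PI) <= W) ->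
  forall a, Cmod a < rho ->
  Rpower (rho - Cmod a) (/ s) * Cmod (G a) <= Rpower (Rpower 2 (/ s) * (W / PI)) (/ s).
Proof.
intros HG Hs Hrho HW HI a Ha. pose proof PI_RGT_0 as Hpi.
set (E := fun x => exists z, Cmod z < rho /\ x = Rpower (rho - Cmod z) (/ s) * Cmod (G z)).
assert (His : 0 < / s) by (apply Rinv_0_lt_compat; lra).
destruct (completeness E) as [Phi [HPhi1 HPhi2]].
(* The supremum must be known to be finite before it can be absorbed. The Cauchy estimate on the
   circle of radius [r'], strictly between rho and 1, provides a crude bound. *)
{ set (r' := (1 + rho) / 2). set (K := RInt (fun t => Cmod (G (polar r' t))) 0 (2 * PI)).
  assert (HK : 0 <= K).
  { apply RInt_ge_0; [lra| |intros; apply Cmod_ge_0].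
    apply (ex_RInt_continuous (V := R_CompleteNormedModule)); intros.
    apply continuous_Cmod, continuous_analytic_polar; auto; unfold r'; lra. }
  exists (/ (PI * (r' - rho)) * K). intros x [z [Hz ->]].
  assert (Hp : Rpower (rho - Cmod z) (/ s) <= 1).
  { pose proof (Cmod_ge_0 z).
    apply ln_le_cancel; [apply Rpower_pos|lra|]. rewrite ln_Rpower, ln_1.
    assert (ln (rho - Cmod z) <= 0) by (rewrite <- ln_1; apply ln_le; lra). nra. }
  pose proof (cauchy_estimate G z r' HG) as Hc. unfold r' in Hc at 1 2.
  specialize (Hc ltac:(lra) ltac:(lra)). fold K in Hc.
  apply (Rle_trans _ (1 * Cmod (G z))).
  { apply Rmult_le_compat_r; [apply Cmod_ge_0|auto]. }
  rewrite Rmult_1_l. eapply Rle_trans; [exact Hc|].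
  apply Rmult_le_compat_r; auto. apply Rinv_le_contravar; unfold r' in *.
  - apply Rmult_lt_0_compat; lra.
  - apply Rmult_le_compat_l; lra. }
{ exists (Rpower (rho - Cmod a) (/ s) * Cmod (G a)), a; auto. }
assert (HPhia : forall z, Cmod z < rho -> Rpower (rho - Cmod z) (/ s) * Cmod (G z) <= Phi).
{ intros z Hz; apply HPhi1; exists z; auto. }
eapply Rle_trans; [now apply HPhia|].
destruct (Rle_lt_dec Phi 0) as [H0|H0].
{ eapply Rle_trans; [exact H0|left; apply Rpower_pos]. }
assert (HM : Phi <= Rpower 2 (/ s) * (W / PI) * Rpower Phi (1 - s)).
{ apply HPhi2. intros x [z [Hz ->]]. pose proof (Cmod_ge_0 z) as Hz0.
  (* The circle halfway between [z] and radius rho, so that r - |z| and rho - r are both y. *)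
  set (r := (Cmod z + rho) / 2). set (y := (rho - Cmod z) / 2).
  assert (Hy : 0 < y) by (unfold y; lra).
  assert (Hr : 0 <= r < rho) by (unfold r; lra).
  pose proof (cauchy_estimate G z r HG) as Hc. unfold r in Hc at 1 2.
  specialize (Hc ltac:(lra) ltac:(lra)).
  replace (r - Cmod z) with y in Hc by (unfold r, y; field).
  (* On that circle |G| <= Phi y^(-1/s), so [k] bounds the factor |G|^(1-s). *)
  set (k := Rpower (Phi * Rpower y (- / s)) (1 - s)).
  assert (Hint : RInt (fun t => Cmod (G (polar r t))) 0 (2 * PI) <= k * W).
  { eapply Rle_trans; [|apply Rmult_le_compat_l; [left; apply Rpower_pos|apply (HI r Hr)]].
    rewrite <- RInt_Rmult_l by (apply ex_RInt_rpow_polar; auto; lra).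
    apply RInt_le; [lra| | |].
    - apply (ex_RInt_continuous (V := R_CompleteNormedModule)); intros.
      apply continuous_Cmod, continuous_analytic_polar; auto; lra.
    - apply ex_RInt_Rmult_l, ex_RInt_rpow_polar; auto; lra.
    - intros t _. set (g := Cmod (G (polar r t))).
      destruct (Cmod_ge_0 (G (polar r t))) as [Hg|Hg]; fold g in Hg.
      2:{ rewrite <- Hg. apply Rmult_le_pos; [left; apply Rpower_pos|apply rpow_ge0]. }
      rewrite rpow_pos_eq by auto.
      assert (Hgle : g <= Phi * Rpower y (- / s)).
      { pose proof (HPhia (polar r t)) as H. rewrite Cmod_polar in H by lra.
        specialize (H ltac:(lra)). replace (rho - r) with y in H by (unfold r, y; field).
        fold g in H. rewrite Rpower_Ropp.
        apply (Rmult_le_reg_l (Rpower y (/ s))); [apply Rpower_pos|].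
        eapply Rle_trans; [exact H|right]. field. apply Rgt_not_eq, Rpower_pos. }
      replace g with (Rpower g (1 - s) * Rpower g s) at 1.
      2:{ rewrite <- Rpower_plus. replace (1 - s + s) with 1 by ring. now apply Rpower_1. }
      apply Rmult_le_compat_r; [left; apply Rpower_pos|].
      apply Rpower_le_l; lra. }
  assert (Hc2 : Cmod (G z) <= / (PI * y) * (k * W)).
  { eapply Rle_trans; [exact Hc|]. apply Rmult_le_compat_l; auto.
    left; apply Rinv_0_lt_compat, Rmult_lt_0_compat; lra. }
  replace (rho - Cmod z) with (2 * y) by (unfold y; field).
  eapply Rle_trans; [apply Rmult_le_compat_l; [left; apply Rpower_pos|exact Hc2]|].
  (* All powers of y cancel: 1/s - 1 - (1 - s)/s = 0. *)
  right. unfold k. apply ln_inv; [ln_pos|ln_pos|]. ln_expand. field. lra. }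
(* From Phi <= C Phi^(1-s) follows Phi^s <= C. *)
apply ln_le_cancel; auto; [apply Rpower_pos|].
assert (HC : 0 < Rpower 2 (/ s) * (W / PI)).
{ apply Rmult_lt_0_compat; [apply Rpower_pos|apply Rdiv_lt_0_compat; lra]. }
apply ln_le in HM; auto.
rewrite ln_mult, ln_Rpower in HM by (auto; apply Rpower_pos).
rewrite ln_Rpower. apply (Rmult_le_reg_l s); [lra|].
rewrite <- Rmult_assoc, Rinv_r, Rmult_1_l by lra. lra.
Qed.

(** * Point evaluations *)

Lemma polar_ex (z : C) : exists th, z = polar (Cmod z) th.
Proof.
destruct (Cmod_ge_0 z) as [Hz|Hz].
2:{ exists 0. rewrite <- Hz. symmetry in Hz; apply Cmod_eq_0 in Hz. subst z.
    unfold polar, RtoC. f_equal; ring. }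
destruct z as [x y]. set (m := Cmod (x, y)) in *.
assert (Em : x * x + y * y = m * m).
{ pose proof (Cmod2_alt (x, y)) as E. fold m in E. simpl in E. lra. }
set (u := x / m).
assert (Ex : x = m * u) by (unfold u; field; lra).
assert (Hu2 : u * u <= 1).
{ apply (Rmult_le_reg_l (m * m)); [nra|]. replace (m * m * (u * u)) with (x * x) by (rewrite Ex; ring). nra. }
assert (Hu : -1 <= u <= 1) by nra.
assert (Hs : (m * sqrt (1 - Rsqr u)) * (m * sqrt (1 - Rsqr u)) = y * y).
{ replace (m * sqrt (1 - Rsqr u) * (m * sqrt (1 - Rsqr u))) with
   (m * m * (sqrt (1 - Rsqr u) * sqrt (1 - Rsqr u))) by ring.
  rewrite sqrt_sqrt by (unfold Rsqr; lra). unfold Rsqr. 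
  replace (m * m * (1 - u * u)) with (m * m - x * x) by (rewrite Ex; ring). lra. }
pose proof (Rmult_le_pos m _ (Rlt_le _ _ Hz) (sqrt_pos (1 - Rsqr u))) as Hp.
destruct (Rle_lt_dec 0 y) as [Hy|Hy].
- exists (acos u). unfold polar. rewrite cos_acos, sin_acos by auto.
  f_equal; [exact Ex|]. nra.
- exists (- acos u). unfold polar. rewrite cos_neg, sin_neg, cos_acos, sin_acos by auto.
  f_equal; [exact Ex|]. nra.
Qed.

Definition kappa (p : Rbar) (alpha : R) : R :=
  alpha + match p with Finite q => / q | _ => 0 end.

Lemma kappa_ge (p : Rbar) (alpha : R) : Rbar_lt (Finite 0) p -> alpha <= kappa p alpha.
Proof.
intros Hp. unfold kappa. destruct p as [q| |]; simpl in Hp; try lra.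
pose proof (Rinv_0_lt_compat q Hp). lra.
Qed.

Lemma Hnorm_le_elim (p : Rbar) (alpha eps : R) (h : C -> C) :
  Rbar_le (Hnorm p alpha h) (Finite eps) ->
  forall r, 0 <= r < 1 -> Rpower (1 - r) alpha * Mp p r h <= eps.
Proof.
intros H r Hr. unfold Hnorm in H.
destruct (Lub_Rbar_correct (fun x => exists r, 0 <= r < 1 /\ x = Rpower (1 - r) alpha * Mp p r h)) as [Hub _].
specialize (Hub (Rpower (1 - r) alpha * Mp p r h) ltac:(exists r; auto)).
exact (Rbar_le_trans _ _ _ Hub H).
Qed.

(** For p infinite, [Mp] applies [real], which sends an infinite supremum to 0; this bound excludes
    that default value. It is uniform in the angle because the Cauchy estimate on the larger circle
    involves only the modulus of the point. *)
Lemma analytic_bounded_circle (h : C -> C) (r : R) : analytic_on_disk h -> 0 <= r < 1 ->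
  exists M, forall th, Cmod (h (polar r th)) <= M.
Proof.
intros Hh Hr. eexists. intros th.
pose proof (cauchy_estimate h (polar r th) ((1 + r) / 2) Hh) as H.
rewrite Cmod_polar in H by lra. apply H; lra.
Qed.

Lemma Cmod_le_Mp_infty (h : C -> C) (z : C) : analytic_on_disk h -> in_disk z ->
  Cmod (h z) <= Mp p_infty (Cmod z) h.
Proof.
intros Hh Hz. unfold Mp.
destruct (Lub_Rbar_correct (fun x => exists th, x = Cmod (h (polar (Cmod z) th)))) as [Hub Hlub].
destruct (analytic_bounded_circle h (Cmod z) Hh (conj (Cmod_ge_0 z) Hz)) as [M HM].
destruct (polar_ex z) as [th Hth].
specialize (Hub (Cmod (h z)) ltac:(exists th; now rewrite <- Hth)).
specialize (Hlub M ltac:(intros x [t ->]; apply HM)).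
destruct (Lub_Rbar _); simpl in *; tauto || auto.
Qed.

Lemma Mp_finite_le (q b r : R) (h : C -> C) : 0 < q -> 0 < b ->
  Mp (Finite q) r h <= b ->
  RInt (fun t => rpow (Cmod (h (polar r t))) q) 0 (2 * PI) <= 2 * PI * Rpower b q.
Proof.
intros Hq Hb H. pose proof PI_RGT_0 as Hpi. unfold Mp in H.
set (I := RInt (fun t => rpow (Cmod (h (polar r t))) q) 0 (2 * PI)) in *.
destruct (Rle_lt_dec I 0) as [HI|HI].
{ pose proof (Rpower_pos b q). nra. }
assert (HI2 : 0 < I / (2 * PI)) by (apply Rdiv_lt_0_compat; lra).
rewrite rpow_pos_eq in H by auto.
apply ln_le in H; [|apply Rpower_pos]. rewrite ln_Rpower in H.
apply ln_le_cancel; [auto|ln_pos|].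
replace I with (I / (2 * PI) * (2 * PI)) by (field; lra).
rewrite ln_mult, (ln_mult (2 * PI)), ln_Rpower by (auto; ln_pos).
apply (Rmult_le_compat_l q) in H; [|lra].
replace (q * (1 / q * ln (I / (2 * PI)))) with (ln (I / (2 * PI))) in H by (field; lra). lra.
Qed.

Theorem point_evaluation (p : Rbar) (alpha : R) : Rbar_lt (Finite 0) p -> 0 < alpha ->
  exists C0, 0 < C0 /\ forall h, analytic_on_disk h -> forall eps, 0 < eps ->
    Rbar_le (Hnorm p alpha h) (Finite eps) -> forall a, in_disk a ->
    Rpower (1 - Cmod a) (kappa p alpha) * Cmod (h a) <= C0 * eps.
Proof.
intros Hp Ha. destruct p as [q| |]; simpl in Hp; [| |contradiction].
(* The absorption argument needs an exponent at most 1, so it is applied to h^n with s = q / n,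
   where |h^n|^s = |h|^q. *)
- destruct (INR_unbounded q) as [n Hn].
  set (s := q / INR n).
  assert (Hn0 : 0 < INR n) by lra.
  assert (Hs : 0 < s <= 1).
  { unfold s; split; [now apply Rdiv_lt_0_compat|].
    apply (Rmult_le_reg_r (INR n)); auto. unfold Rdiv; rewrite Rmult_assoc, Rinv_l by lra. lra. }
  exists (Rpower 2 (kappa q alpha) * Rpower (Rpower 2 (/ s) * 2) (/ q)); split; [ln_pos|].
  intros h Hh eps Heps HN a Hin.
  pose proof (Cmod_ge_0 a) as Ha0. unfold in_disk in Hin.
  destruct (Cmod_ge_0 (h a)) as [Hpos|H0].
  2:{ rewrite <- H0, Rmult_0_r. left; ln_pos. }
  (* Both 1 - rho and rho - |a| equal y, so circles inside radius rho carry a weight of at least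
     y^alpha, and [b] below bounds M_p on them. *)
  set (y := (1 - Cmod a) / 2). set (rho := (1 + Cmod a) / 2).
  assert (Hy : 0 < y) by (unfold y; lra).
  pose proof PI_RGT_0 as Hpi.
  set (b := eps * Rpower y (- alpha)).
  assert (Hb : 0 < b) by (unfold b; ln_pos).
  pose proof (sup_bound_small_exponent (fun z => h z ^ n)%C s rho (2 * PI * Rpower b q)) as H.
  assert (HG : analytic_on_disk (fun z => h z ^ n)%C).
  { intros z Hz. apply ex_derive_cderiv, cderiv_pow, analytic_cderiv; auto. }
  specialize (H HG Hs ltac:(unfold rho; lra) ltac:(ln_pos)).
  assert (Hint : forall r : R, 0 <= r < rho ->
    RInt (fun t : R => rpow (Cmod (h (polar r t) ^ n)%C) s) 0 (2 * PI) <= 2 * PI * Rpower b q).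
  { intros r Hr.
    assert (Hr1 : 0 <= r < 1) by (unfold rho in Hr; lra).
    pose proof (Hnorm_le_elim _ _ _ _ HN r Hr1) as HM.
    erewrite RInt_ext.
    2:{ intros t _. instantiate (1 := fun t => rpow (Cmod (h (polar r t))) q). simpl.
        rewrite Cmod_pow. destruct (Cmod_ge_0 (h (polar r t))) as [Hg|Hg].
        - rewrite <- Rpower_pow by auto. rewrite !rpow_pos_eq by (auto; apply Rpower_pos).
          rewrite Rpower_mult. f_equal. unfold s; field; lra.
        - rewrite <- Hg. rewrite pow_i, !rpow_0; auto. apply INR_lt; simpl; lra. }
    apply Mp_finite_le; auto.
    unfold b. rewrite Rpower_Ropp.
    apply (Rmult_le_reg_l (Rpower y alpha)); [apply Rpower_pos|].
    replace (Rpower y alpha * (eps * / Rpower y alpha)) with eps by (field; apply Rgt_not_eq, Rpower_pos).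
    eapply Rle_trans; [|exact HM]. apply Rmult_le_compat_r; [apply rpow_ge0|].
    apply Rpower_le_l; unfold y, rho in *; lra. }
  specialize (H Hint a ltac:(unfold rho; lra)). simpl in H.
  replace (rho - Cmod a) with y in H by (unfold rho, y; field).
  rewrite Cmod_pow, <- Rpower_pow in H by auto.
  apply ln_le in H; [|ln_pos].
  apply ln_le_cancel; [ln_pos|ln_pos|].
  replace (1 - Cmod a) with (2 * y) by (unfold y; field).
  revert H. unfold b, kappa. ln_expand. intros H.
  apply (Rmult_le_compat_l (/ INR n)) in H; [|left; now apply Rinv_0_lt_compat].
  unfold s in *.
  replace (/ (q * / INR n)) with (INR n * / q) in * by (field; repeat split; lra).
  revert H. 
  match goal with |- ?A <= ?B -> _ => replace A with (/ q * ln y + ln (Cmod (h a))) by (field; repeat split; lra);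
    replace B with (/ q * (INR n * / q * ln 2 + ln 2) + (ln eps - alpha * ln y)) by (field; repeat split; lra) end.
  intros H. replace (/ (q / INR n)) with (INR n * / q) by (field; lra). lra.
- exists 1; split; [lra|]. intros h Hh eps Heps HN a Hin.
  pose proof (Cmod_le_Mp_infty h a Hh Hin) as H.
  pose proof (Hnorm_le_elim _ _ _ _ HN (Cmod a) (conj (Cmod_ge_0 a) Hin)) as H2.
  unfold kappa. rewrite Rplus_0_r, Rmult_1_l. eapply Rle_trans; [|exact H2].
  apply Rmult_le_compat_l; auto. left; apply Rpower_pos.
Qed.

(** * Kernel functions *)

Lemma one_minus_lower (a z : C) : 1 - Cmod a * Cmod z <= Cmod (1 - Cconj a * z)%C.
Proof.
pose proof (Cmod_triangle_inv 1 (Cconj a * z)%C) as H.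
now rewrite Cmod_1, Cmod_mult, Cmod_conj in H.
Qed.

Lemma one_minus_prod_pos (a z : C) : in_disk a -> in_disk z -> 0 < 1 - Cmod a * Cmod z.
Proof.
unfold in_disk; intros Ha Hz. pose proof (Cmod_ge_0 a); pose proof (Cmod_ge_0 z). nra.
Qed.

Lemma one_minus_neq0 (a z : C) : in_disk a -> in_disk z -> (1 - Cconj a * z)%C <> 0%C.
Proof.
intros Ha Hz. apply Cmod_gt_0. pose proof (one_minus_lower a z).
pose proof (one_minus_prod_pos a z Ha Hz). lra.
Qed.

Definition szego (a z : C) : C := (/ (1 - Cconj a * z))%C.

Lemma szego_analytic (a : C) : in_disk a -> analytic_on_disk (szego a).
Proof.
intros Ha z Hz. apply ex_derive_cderiv. eexists.
apply (cderiv_comp (fun w => / w)%C (fun z => 1 - Cconj a * z)%C).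
- apply cderiv_inv. now apply one_minus_neq0.
- pose proof (cderiv_affine (- Cconj a)%C 1 z) as H.
  replace (fun z => 1 - Cconj a * z)%C with (fun z => - Cconj a * z + 1)%C; [exact H|].
  apply functional_extensionality; intros; ring.
Qed.

Lemma Cmod_szego (a z : C) : in_disk a -> in_disk z ->
  Cmod (szego a z) = / Cmod (1 - Cconj a * z)%C.
Proof. intros; unfold szego; apply Cmod_inv, one_minus_neq0; auto. Qed.

Lemma polar_0 (th : R) : polar 0 th = 0%C.
Proof. unfold polar, RtoC; f_equal; ring. Qed.

Lemma in_disk_polar (r th : R) : 0 <= r < 1 -> in_disk (polar r th).
Proof. intros; unfold in_disk; rewrite Cmod_polar; lra. Qed.

(** The Poisson kernel identity (1 - |w|^2) / |1 - w|^2 = 2 Re (1 / (1 - w)) - 1 for w = conj(a) z.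
    It expresses the squared modulus through the real part of an analytic function. *)
Lemma re_szego (a z : C) : in_disk a -> in_disk z ->
  (1 - (Cmod a * Cmod z) ^ 2) * Cmod (szego a z) ^ 2 = 2 * fst (szego a z) - 1.
Proof.
intros Ha Hz. pose proof (one_minus_neq0 a z Ha Hz) as Hn.
rewrite Cmod_szego by auto.
rewrite <- Cmod_conj, <- Cmod_mult. unfold szego.
set (w := (Cconj a * z)%C) in *.
apply Cmod_gt_0 in Hn. pose proof (pow_lt _ 2 Hn) as Hp.
rewrite pow_inv, !Cmod2_alt. rewrite Cmod2_alt in Hp.
destruct w as [u v]; simpl in *. field.
unfold Rminus. lra.
Qed.

(** By [re_szego] and the mean value property, with szego a 0 = 1, the integral is exactly 2 PI / (1
    - x^2) for x = |a| r. *)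
Lemma RInt_szego (a : C) (r : R) : in_disk a -> 0 <= r < 1 ->
  RInt (fun t => Cmod (szego a (polar r t)) ^ 2) 0 (2 * PI) <= 2 * PI / (1 - Cmod a * r).
Proof.
intros Ha Hr. pose proof PI_RGT_0 as Hpi. pose proof (Cmod_ge_0 a) as Ha0.
pose proof (szego_analytic a Ha) as Han.
assert (cs : forall t, ccontinuous (fun t => szego a (polar r t)) t)
  by (intros; now apply continuous_analytic_polar).
assert (exr : ex_RInt (fun t => fst (szego a (polar r t))) 0 (2 * PI)).
{ apply (ex_RInt_continuous (V := R_CompleteNormedModule)); intros t _.
  apply (continuous_C_Re _ t (cs t)). }
assert (E0 : szego a 0 = 1%C) by (unfold szego; field; apply C1_nz).
assert (E1 : RInt (fun t => fst (szego a (polar r t))) 0 (2 * PI) = 2 * PI).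
{ rewrite <- (CInt_re (fun t => szego a (polar r t))) by (auto; lra).
  destruct (Req_dec r 0) as [->|Hr0].
  - rewrite (CInt_ext _ (fun _ => 1%C)); [|lra|intros; now rewrite polar_0].
    rewrite CInt_const. simpl. ring.
  - rewrite mean_value, E0; auto; [|lra]. simpl; ring. }
set (x := Cmod a * r). assert (Hx : 0 <= x < 1) by (unfold x, in_disk in *; nra).
assert (E2 : RInt (fun t => Cmod (szego a (polar r t)) ^ 2) 0 (2 * PI) = 2 * PI / (1 - x ^ 2)).
{ rewrite (RInt_ext _ (fun t => / (1 - x ^ 2) * (2 * fst (szego a (polar r t)) - 1))).
  2:{ intros t _. rewrite <- re_szego, Cmod_polar by (auto; try apply in_disk_polar; lra).
      fold x. match goal with |- ?A = ?B => change (@eq R A B) end. field. simpl; nra. }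
  assert (ex2 : ex_RInt (fun t => 2 * fst (szego a (polar r t))) 0 (2 * PI)) by now apply ex_RInt_Rmult_l.
  assert (ex1 : ex_RInt (fun _ : R => 1) 0 (2 * PI)) by apply ex_RInt_const.
  rewrite RInt_Rmult_l.
  2:{ exact (ex_RInt_minus (V := R_NormedModule) _ _ _ _ ex2 ex1). }
  rewrite RInt_Rminus, RInt_Rmult_l, E1, RInt_Rconst by auto.
  match goal with |- ?A = ?B => change (@eq R A B) end. field. simpl; nra. }
rewrite E2. unfold Rdiv. apply Rmult_le_compat_l; [lra|].
apply Rinv_le_contravar; simpl; nra.
Qed.

Definition hump (N : nat) (k : R) (a z : C) : C :=
  (RtoC (Rpower (1 - Cmod a) (INR N - k)) * szego a z ^ N)%C.

Lemma Cmod_hump (N : nat) (k : R) (a z : C) : in_disk a -> in_disk z ->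
  Cmod (hump N k a z) =
  Rpower (1 - Cmod a) (INR N - k) * Rpower (Cmod (1 - Cconj a * z)%C) (- INR N).
Proof.
intros Ha Hz. pose proof (one_minus_neq0 a z Ha Hz) as Hn. apply Cmod_gt_0 in Hn.
unfold hump. rewrite Cmod_mult, Cmod_R, Cmod_pow, Cmod_szego by auto.
rewrite Rabs_pos_eq by (left; apply Rpower_pos).
rewrite Rpower_Ropp, Rpower_pow, pow_inv by auto. reflexivity.
Qed.

Lemma hump_analytic N k a : in_disk a -> analytic_on_disk (hump N k a).
Proof.
intros Ha z Hz. apply ex_derive_cderiv.
destruct (cderiv_pow (szego a) z N (analytic_cderiv _ z (szego_analytic a Ha) Hz)) as [l Hl].
exists (RtoC (Rpower (1 - Cmod a) (INR N - k)) * l + 0)%C.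
pose proof (cderiv_comp (fun w => RtoC (Rpower (1 - Cmod a) (INR N - k)) * w + 0)%C
  (fun w => szego a w ^ N)%C z _ _ (cderiv_affine _ _ _) Hl) as H.
replace (hump N k a) with (fun w => RtoC (Rpower (1 - Cmod a) (INR N - k)) * szego a w ^ N + 0)%C.
- replace (RtoC (Rpower (1 - Cmod a) (INR N - k)) * l + 0)%C with (l * RtoC (Rpower (1 - Cmod a) (INR N - k)))%C by ring.
  exact H.
- apply functional_extensionality; intros; unfold hump; ring.
Qed.

(** Both 1 - |a| and 1 - |z| are at most |1 - conj(a) z|, and the exponents k, N - k and -N add up
    to 0. *)
Lemma Cmod_hump_weight_le (N : nat) (k : R) (a z : C) : in_disk a -> in_disk z ->
  0 <= k -> k <= INR N ->
  Rpower (1 - Cmod z) k * Cmod (hump N k a z) <= 1.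
Proof.
intros Ha Hz H1 H2. rewrite Cmod_hump by auto.
pose proof (one_minus_lower a z) as HX. pose proof (one_minus_prod_pos a z Ha Hz) as Hp.
set (X := Cmod (1 - Cconj a * z)%C) in *. unfold in_disk in *.
pose proof (Cmod_ge_0 a); pose proof (Cmod_ge_0 z).
apply ln_le_cancel; [ln_pos|lra|]. ln_expand. rewrite ln_1.
assert (L1 : ln (1 - Cmod a) <= ln X) by (apply ln_le; nra).
assert (L2 : ln (1 - Cmod z) <= ln X) by (apply ln_le; nra).
nra.
Qed.

Lemma RInt_hump_le (N : nat) (alpha q : R) (a : C) (r : R) : in_disk a -> 0 <= r < 1 ->
  0 < q -> 0 < alpha -> 2 <= INR N * q -> alpha + / q <= INR N ->
  RInt (fun t => rpow (Rpower (1 - r) alpha * Cmod (hump N (alpha + / q) a (polar r t))) q) 0 (2 * PI)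
  <= 2 * PI.
Proof.
intros Ha Hr Hq Hal HNq HN. pose proof PI_RGT_0 as Hpi. pose proof (Cmod_ge_0 a) as Ha0.
set (k := alpha + / q) in *. set (x := 1 - Cmod a * r).
assert (Hx : 0 < x) by (unfold x, in_disk in *; nra).
set (c := Rpower (1 - r) (alpha * q) * Rpower (1 - Cmod a) ((INR N - k) * q) * Rpower x (2 - INR N * q)).
assert (Hc : 0 < c) by (unfold c; ln_pos).
assert (Han : analytic_on_disk (szego a)) by now apply szego_analytic.
assert (exs : ex_RInt (fun t => Cmod (szego a (polar r t)) ^ 2) 0 (2 * PI)).
{ apply (ex_RInt_continuous (V := R_CompleteNormedModule)); intros t _.
  apply (continuous_comp (fun t => Cmod (szego a (polar r t))) (fun y => y ^ 2)).
  - apply continuous_Cmod, continuous_analytic_polar; auto.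
  - apply (ex_derive_continuous (K := R_AbsRing) (V := R_NormedModule)); auto_derive; auto. }
apply (Rle_trans _ (RInt (fun t => c * Cmod (szego a (polar r t)) ^ 2) 0 (2 * PI))).
- apply RInt_le; [lra| | |].
  + apply (ex_RInt_continuous (V := R_CompleteNormedModule)); intros t _.
    apply (continuous_comp (fun t => Rpower (1 - r) alpha * Cmod (hump N k a (polar r t))) (fun y => rpow y q)).
    * apply (continuous_mult (fun _ => Rpower (1 - r) alpha)); [apply continuous_const|].
      apply continuous_Cmod, continuous_analytic_polar; auto.
      now apply hump_analytic.
    * now apply continuous_rpow.
  + now apply ex_RInt_Rmult_l.
  + intros t _.
    pose proof (in_disk_polar r t Hr) as Hz.
    rewrite Cmod_hump, Cmod_szego by auto.
    pose proof (one_minus_lower a (polar r t)) as HX. rewrite Cmod_polar in HX by lra. fold x in HX.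
    set (X := Cmod (1 - Cconj a * polar r t)%C) in *.
    assert (HX0 : 0 < X) by lra.
    rewrite rpow_pos_eq by ln_pos.
    rewrite <- Rpower_pow by ln_pos.
    unfold in_disk in *.
    apply ln_le_cancel; [ln_pos|ln_pos|]. unfold c. ln_expand.
    assert (ln x <= ln X) by (apply ln_le; lra). simpl. nra.
- rewrite RInt_Rmult_l by auto.
  eapply Rle_trans; [apply Rmult_le_compat_l; [lra|now apply RInt_szego]|]. fold x.
  unfold Rdiv. rewrite (Rmult_comm c), Rmult_assoc. rewrite <- (Rmult_1_r (2 * PI)) at 2.
  apply Rmult_le_compat_l; [lra|].
  unfold in_disk in *.
  apply ln_le_cancel; [ln_pos|lra|]. unfold c. ln_expand. rewrite ln_1.
  assert (L1 : ln (1 - Cmod a) <= ln x) by (apply ln_le; unfold x; nra).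
  assert (L2 : ln (1 - r) <= ln x) by (apply ln_le; unfold x; nra).
  assert (E : (INR N - k) * q = INR N * q - alpha * q - 1) by (unfold k; field; lra).
  assert (0 <= (INR N - k) * q) by (apply Rmult_le_pos; lra).
  rewrite E in *. assert (0 <= alpha * q) by nra.
  nra.
Qed.

(** A sum of three terms is at most three times the largest. This replaces Minkowski's inequality
    and is valid for every q > 0. *)
Lemma rpow_sum3_le (x y z q : R) : 0 < q -> 0 <= x -> 0 <= y -> 0 <= z ->
  rpow (x + y + z) q <= Rpower 3 q * (rpow x q + rpow y q + rpow z q).
Proof.
intros Hq Hx Hy Hz.
pose proof (rpow_ge0 x q); pose proof (rpow_ge0 y q); pose proof (rpow_ge0 z q).
assert (E : forall u, 0 <= u -> rpow (3 * u) q = Rpower 3 q * rpow u q).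
{ intros u [Hu|<-].
  - rewrite !rpow_pos_eq, Rpower_mult_distr by lra; auto.
  - rewrite Rmult_0_r, rpow_0; ring. }
pose proof (Rpower_pos 3 q).
assert (exists u, (u = x \/ u = y \/ u = z) /\ x + y + z <= 3 * u) as [u [Hu Hle]].
{ destruct (Rle_lt_dec x y), (Rle_lt_dec y z), (Rle_lt_dec x z);
  solve [exists x; split; [auto|lra]|exists y; split; [auto|lra]|exists z; split; [auto|lra]]. }
eapply Rle_trans; [apply (rpow_le _ (3 * u) q Hq Hle)|].
rewrite E by (destruct Hu as [->|[->| ->]]; auto).
apply Rmult_le_compat_l; [lra|]. destruct Hu as [->|[->| ->]]; lra.
Qed.

(** * Criteria for a finite norm *)

Lemma Hnorm_lt_infty (p : Rbar) (alpha B : R) (f : C -> C) :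
  (forall r, 0 <= r < 1 -> Rpower (1 - r) alpha * Mp p r f <= B) ->
  Rbar_lt (Hnorm p alpha f) p_infty.
Proof.
intros H. apply (Rbar_le_lt_trans _ (Finite B)); [|exact I].
apply Lub_Rbar_correct. intros x [r [Hr ->]]. apply H, Hr.
Qed.

(** The two dominating kernels may change with the circle, because the integral bound for a kernel
    is uniform in its centre and in the radius. *)
Lemma Hnorm_two_humps (p : Rbar) (alpha M : R) (N : nat) (f : C -> C) :
  Rbar_lt (Finite 0) p -> 0 < alpha -> kappa p alpha <= INR N ->
  (forall q, p = Finite q -> 2 <= INR N * q) -> 0 <= M -> analytic_on_disk f ->
  (forall r, 0 <= r < 1 -> exists a b, in_disk a /\ in_disk b /\ forall th,
    Rpower (1 - r) alpha * Cmod (f (polar r th)) <=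
    Rpower (1 - r) alpha * Cmod (hump N (kappa p alpha) a (polar r th)) +
    Rpower (1 - r) alpha * Cmod (hump N (kappa p alpha) b (polar r th)) + M) ->
  Rbar_lt (Hnorm p alpha f) p_infty.
Proof.
intros Hp Hal HN HNq HM Hf H. pose proof PI_RGT_0 as Hpi.
destruct p as [q| |]; simpl in Hp; [| |contradiction].
- specialize (HNq q eq_refl). unfold kappa in *.
  set (B := Rpower 3 q * (2 + rpow M q)).
  assert (HB : 0 < B) by (unfold B; pose proof (rpow_ge0 M q); ln_pos).
  apply (Hnorm_lt_infty _ _ (Rpower B (/ q))).
  intros r Hr. destruct (H r Hr) as (a & b & Ha & Hb & Hab). clear H.
  set (w := Rpower (1 - r) alpha) in *. assert (Hw : 0 < w) by apply Rpower_pos.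
  set (xa := fun t => w * Cmod (hump N (alpha + / q) a (polar r t))) in *.
  set (xb := fun t => w * Cmod (hump N (alpha + / q) b (polar r t))) in *.
  assert (Hxa0 : forall t, 0 <= xa t) by (intros; apply Rmult_le_pos; [lra|apply Cmod_ge_0]).
  assert (Hxb0 : forall t, 0 <= xb t) by (intros; apply Rmult_le_pos; [lra|apply Cmod_ge_0]).
  pose proof (RInt_hump_le N alpha q a r Ha Hr Hp Hal HNq HN) as Ia.
  pose proof (RInt_hump_le N alpha q b r Hb Hr Hp Hal HNq HN) as Ib.
  assert (Hex : forall a, in_disk a -> ex_RInt (fun t => rpow (w * Cmod (hump N (alpha + / q) a (polar r t))) q) 0 (2 * PI)).
  { intros a' Ha'. apply (ex_RInt_continuous (V := R_CompleteNormedModule)); intros t _.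
    apply (continuous_comp (fun t => w * Cmod (hump N (alpha + / q) a' (polar r t))) (fun y => rpow y q)).
    - apply (continuous_mult (fun _ => w)); [apply continuous_const|].
      apply continuous_Cmod, continuous_analytic_polar; auto. now apply hump_analytic.
    - now apply continuous_rpow. }
  pose proof (Hex a Ha) as Ea. pose proof (Hex b Hb) as Eb.
  fold w in Ia, Ib. change (RInt (fun t => rpow (xa t) q) 0 (2 * PI) <= 2 * PI) in Ia.
  change (RInt (fun t => rpow (xb t) q) 0 (2 * PI) <= 2 * PI) in Ib.
  change (ex_RInt (fun t => rpow (xa t) q) 0 (2 * PI)) in Ea.
  change (ex_RInt (fun t => rpow (xb t) q) 0 (2 * PI)) in Eb.
  pose proof (ex_RInt_rpow_polar f r q Hf Hr Hp) as Ef.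
  set (I := RInt (fun t => rpow (Cmod (f (polar r t))) q) 0 (2 * PI)).
  assert (HI : Rpower w q * I <= 2 * PI * B).
  { unfold I. rewrite <- RInt_Rmult_l by auto.
    assert (E1 := ex_RInt_plus (V := R_NormedModule) _ _ _ _ Ea Eb).
    assert (E2 := ex_RInt_const (V := R_NormedModule) 0 (2 * PI) (rpow M q)).
    assert (E3 := ex_RInt_plus (V := R_NormedModule) _ _ _ _ E1 E2).
    eapply Rle_trans.
    - apply (RInt_le _ (fun t => Rpower 3 q * (rpow (xa t) q + rpow (xb t) q + rpow M q))); [lra| | |].
      + now apply ex_RInt_Rmult_l.
      + apply ex_RInt_Rmult_l. exact E3.
      + intros t _. eapply Rle_trans; [|apply rpow_sum3_le; auto].
        eapply Rle_trans; [|apply rpow_le; [auto|apply Hab]].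
        right. destruct (Cmod_ge_0 (f (polar r t))) as [H0|H0].
        * rewrite !rpow_pos_eq, Rpower_mult_distr by ln_pos; auto.
        * rewrite <- H0, Rmult_0_r, rpow_0; ring.
    - rewrite RInt_Rmult_l by exact E3.
      rewrite RInt_Rplus, RInt_Rplus, RInt_Rconst by auto.
      unfold B. rewrite <- Rmult_assoc, (Rmult_comm (2 * PI)), Rmult_assoc.
      apply Rmult_le_compat_l; [left; apply Rpower_pos|]. lra. }
  unfold Mp. fold I.
  destruct (Rle_lt_dec (I / (2 * PI)) 0) as [H0|H0].
  { unfold rpow. destruct (Rle_dec (I / (2 * PI)) 0); [|lra]. rewrite Rmult_0_r. left; apply Rpower_pos. }
  rewrite rpow_pos_eq by auto.
  assert (HI2 : Rpower w q * (I / (2 * PI)) <= B).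
  { apply (Rmult_le_reg_l (2 * PI)); [lra|].
    replace (2 * PI * (Rpower w q * (I / (2 * PI)))) with (Rpower w q * I) by (field; lra). lra. }
  apply ln_le in HI2; [|apply Rmult_lt_0_compat; [apply Rpower_pos|auto]].
  rewrite ln_mult, ln_Rpower in HI2 by (auto; apply Rpower_pos).
  apply ln_le_cancel; [ln_pos|ln_pos|].
  rewrite ln_mult, !ln_Rpower by (auto; apply Rpower_pos).
  apply (Rmult_le_reg_l q); auto.
  replace (q * (/ q * ln B)) with (ln B) by (field; lra).
  replace (q * (ln w + 1 / q * ln (I / (2 * PI)))) with (q * ln w + ln (I / (2 * PI))) by (field; lra).
  exact HI2.
- unfold kappa in *. rewrite Rplus_0_r in *.
  apply (Hnorm_lt_infty _ _ (2 + M)). intros r Hr.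
  destruct (H r Hr) as (a & b & Ha & Hb & Hab). clear H.
  set (w := Rpower (1 - r) alpha) in *. assert (Hw : 0 < w) by apply Rpower_pos.
  assert (Hth : forall th, w * Cmod (f (polar r th)) <= 2 + M).
  { intros th. pose proof (in_disk_polar r th Hr) as Hz.
    pose proof (Cmod_hump_weight_le N alpha a (polar r th) Ha Hz ltac:(lra) HN) as Ka.
    pose proof (Cmod_hump_weight_le N alpha b (polar r th) Hb Hz ltac:(lra) HN) as Kb.
    rewrite Cmod_polar in Ka, Kb by lra. fold w in Ka, Kb. specialize (Hab th). lra. }
  unfold Mp.
  destruct (Lub_Rbar_correct (fun x => exists th, x = Cmod (f (polar r th)))) as [Hub Hlub].
  specialize (Hub (Cmod (f (polar r 0))) ltac:(exists 0; auto)).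
  specialize (Hlub ((2 + M) / w)).
  assert (Hle : Rbar_le (Lub_Rbar (fun x => exists th, x = Cmod (f (polar r th)))) ((2 + M) / w)).
  { apply Hlub. intros x [t ->]. simpl. apply (Rmult_le_reg_l w); auto.
    replace (w * ((2 + M) / w)) with (2 + M) by (field; lra). apply Hth. }
  destruct (Lub_Rbar _) as [L| |]; simpl in *; [|contradiction|contradiction].
  apply (Rmult_le_compat_l w) in Hle; [|lra].
  replace (w * ((2 + M) / w)) with (2 + M) in Hle by (field; lra). exact Hle.
Qed.

(** * Series of kernel functions *)

Definition CSeries (u : nat -> C) : C :=
  (Series (fun n => fst (u n)), Series (fun n => snd (u n))).

Definition csummable (u : nat -> C) : Prop := ex_series (fun n => Cmod (u n)).

Lemma csummable_le (u : nat -> C) (b : nat -> R) : ex_series b ->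
  (forall n, Cmod (u n) <= b n) -> csummable u.
Proof.
intros Hb H. apply (ex_series_le (V := R_CompleteNormedModule) _ b); auto.
intros n. change (Rabs (Cmod (u n)) <= b n). rewrite Rabs_pos_eq; [auto|apply Cmod_ge_0].
Qed.

Lemma csummable_fst (u : nat -> C) : csummable u -> ex_series (fun n => fst (u n)).
Proof.
intros H. apply (ex_series_le (V := R_CompleteNormedModule) _ (fun n => Cmod (u n))); auto.
intros n. eapply Rle_trans; [apply Rmax_l|apply Rmax_Cmod].
Qed.

Lemma csummable_snd (u : nat -> C) : csummable u -> ex_series (fun n => snd (u n)).
Proof.
intros H. apply (ex_series_le (V := R_CompleteNormedModule) _ (fun n => Cmod (u n))); auto.
intros n. eapply Rle_trans; [apply Rmax_r|apply Rmax_Cmod].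
Qed.

Lemma CSeries_minus (u v : nat -> C) : csummable u -> csummable v ->
  CSeries (fun n => u n - v n)%C = (CSeries u - CSeries v)%C.
Proof.
intros Hu Hv. apply injective_projections; simpl.
- exact (Series_minus _ _ (csummable_fst u Hu) (csummable_fst v Hv)).
- exact (Series_minus _ _ (csummable_snd u Hu) (csummable_snd v Hv)).
Qed.

Lemma CSeries_mult_l (k : C) (u : nat -> C) : csummable u ->
  CSeries (fun n => k * u n)%C = (k * CSeries u)%C.
Proof.
intros Hu. pose proof (csummable_fst u Hu) as H1. pose proof (csummable_snd u Hu) as H2.
assert (S : forall (c : R) (v : nat -> R), ex_series v -> ex_series (fun n => c * v n))
  by (intros c v Hv; exact (ex_series_scal_l (K := R_AbsRing) (V := R_NormedModule) c v Hv)).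
destruct k as [k1 k2]. apply injective_projections; simpl.
- rewrite <- !Series_scal_l, <- Series_minus by auto. reflexivity.
- rewrite <- !Series_scal_l, <- Series_plus by auto. reflexivity.
Qed.

Lemma csummable_minus (u v : nat -> C) : csummable u -> csummable v ->
  csummable (fun n => u n - v n)%C.
Proof.
intros Hu Hv. apply (csummable_le _ (fun n => Cmod (u n) + Cmod (v n))).
- exact (ex_series_plus (K := R_AbsRing) (V := R_NormedModule) _ _ Hu Hv).
- intros; apply Cmod_sub_le.
Qed.

Lemma csummable_mult_l (k : C) (u : nat -> C) : csummable u -> csummable (fun n => k * u n)%C.
Proof.
intros Hu. apply (csummable_le _ (fun n => Cmod k * Cmod (u n))).
- exact (ex_series_scal_l (K := R_AbsRing) (V := R_NormedModule) _ _ Hu).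
- intros; rewrite Cmod_mult; lra.
Qed.

(* With S = CSeries u, |S|^2 is the sum of the inner products of S with the u n. *)
Lemma Cmod_CSeries_le (u : nat -> C) (b : nat -> R) : ex_series b ->
  (forall n, Cmod (u n) <= b n) -> Cmod (CSeries u) <= Series b.
Proof.
intros Hb H. pose proof (csummable_le u b Hb H) as Hu.
pose proof (csummable_fst u Hu) as H1. pose proof (csummable_snd u Hu) as H2.
pose proof (Cmod2_alt (CSeries u)) as E. simpl in E.
set (X := Series (fun n => fst (u n))) in *. set (Y := Series (fun n => snd (u n))) in *.
set (m := Cmod (CSeries u)) in *. assert (Hm : 0 <= m) by apply Cmod_ge_0.
assert (SC : forall (c : R) (v : nat -> R), ex_series v -> ex_series (fun n => c * v n))
  by (intros c v Hv; exact (ex_series_scal_l (K := R_AbsRing) (V := R_NormedModule) c v Hv)).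
assert (E2 : m * m = Series (fun n => X * fst (u n) + Y * snd (u n))).
{ rewrite Series_plus, !Series_scal_l by auto. fold X Y. lra. }
assert (Ht : forall n, Rabs (X * fst (u n) + Y * snd (u n)) <= m * b n).
{ intros n. apply (Rle_trans _ (m * Cmod (u n))); [|apply Rmult_le_compat_l; auto].
  replace (m * Cmod (u n)) with (Cmod (Cconj (X, Y) * u n)%C)
    by (rewrite Cmod_mult, Cmod_conj; reflexivity).
  eapply Rle_trans; [|apply re_le_Cmod]. unfold Re; simpl. right; f_equal; ring. }
assert (Hle : m * m <= m * Series b).
{ rewrite E2, <- Series_scal_l.
  eapply Rle_trans; [apply Rle_abs|]. eapply Rle_trans; [apply Series_Rabs|].
  - apply (ex_series_le (V := R_CompleteNormedModule) _ (fun n => m * b n)); [|now apply SC].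
    intros n. change (Rabs (Rabs (X * fst (u n) + Y * snd (u n))) <= m * b n).
    rewrite Rabs_Rabsolu; auto.
  - apply Series_le; [|now apply SC]. intros n; split; [apply Rabs_pos|auto]. }
destruct Hm as [Hm|Hm].
- apply (Rmult_le_reg_l m); auto.
- rewrite <- Hm.
  assert (0 = Series (fun _ : nat => 0)) as -> by (symmetry; apply is_series_unique;
    apply is_series_Reals; intros e He; exists 0%nat; intros n _;
    rewrite sum_eq_R0 by auto; unfold Rdist; rewrite Rminus_0_r, Rabs_R0; auto).
  apply Series_le; auto. intros n; split; [lra|]. eapply Rle_trans; [apply Cmod_ge_0|apply H].
Qed.

(** The term is replaced by 0 rather than skipped, so that bounds indexed by [n] carry over to the
    rest of the series. *)
Lemma Series_remove (u : nat -> R) (j : nat) : ex_series u ->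
  Series u = u j + Series (fun n => if Nat.eqb n j then 0 else u n).
Proof.
revert u; induction j as [|j IH]; intros u Hu.
- rewrite (Series_incr_1 u Hu), (Series_incr_1 (fun n => if Nat.eqb n 0 then 0 else u n)).
  + simpl. ring.
  + apply ex_series_incr_1. simpl. now apply (ex_series_incr_1 u).
- apply (ex_series_incr_1 u) in Hu as Hu'.
  set (v := fun n => if Nat.eqb n (S j) then 0 else u n).
  assert (Hz : ex_series v).
  { apply (ex_series_incr_n (K := R_AbsRing) (V := R_NormedModule) _ (S (S j))).
    apply (ex_series_incr_n (K := R_AbsRing) (V := R_NormedModule) u (S (S j))) in Hu.
    eapply ex_series_ext; [|exact Hu]. intros n. unfold v.
    destruct (Nat.eqb_spec (S (S j) + n) (S j)); [lia|reflexivity]. }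
  rewrite (Series_incr_1 u Hu), (Series_incr_1 _ Hz), (IH _ Hu'). unfold v; simpl. ring.
Qed.

Lemma CSeries_remove (u : nat -> C) (j : nat) : csummable u ->
  CSeries u = (u j + CSeries (fun n => if Nat.eqb n j then 0 else u n))%C.
Proof.
intros Hu. apply injective_projections; simpl.
- rewrite (Series_remove _ j (csummable_fst u Hu)). f_equal. apply Series_ext.
  intros n; now destruct (Nat.eqb n j).
- rewrite (Series_remove _ j (csummable_snd u Hu)). f_equal. apply Series_ext.
  intros n; now destruct (Nat.eqb n j).
Qed.

(** The constant [M] does not depend on [a], and [d a z] does not depend on [w]; this is what allows
    a series of kernels to be differentiated term by term. The proof is the product rule, by
    induction on [N]. *)
Lemma szego_pow_taylor (N : nat) (rho : R) : 0 <= rho < 1 ->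
  exists (M : R) (d : C -> C -> C), 0 <= M /\ forall a z w, in_disk a ->
    Cmod z <= rho -> Cmod w <= rho ->
    Cmod (szego a z ^ N)%C <= M /\ Cmod (d a z) <= M /\
    Cmod (szego a w ^ N - szego a z ^ N - (w - z) * d a z)%C <= M * Cmod (w - z)%C ^ 2.
Proof.
intros Hrho. set (T := / (1 - rho)).
assert (HT : 0 < T) by (apply Rinv_0_lt_compat; lra).
assert (Hs : forall a z, in_disk a -> Cmod z <= rho -> Cmod (szego a z) <= T).
{ intros a z Ha Hz. assert (in_disk z) by (unfold in_disk; lra).
  rewrite Cmod_szego by auto. apply Rinv_le_contravar; [lra|].
  pose proof (one_minus_lower a z). pose proof (Cmod_ge_0 a); pose proof (Cmod_ge_0 z).
  unfold in_disk in *; nra. }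
assert (Hd : forall a z w, in_disk a -> Cmod z <= rho -> Cmod w <= rho ->
   (szego a w - szego a z = Cconj a * (w - z) * szego a w * szego a z)%C).
{ intros a z w Ha Hz Hw. unfold szego. field.
  split; apply one_minus_neq0; auto; unfold in_disk; lra. }
induction N as [|N (M & d & HM & IH)].
- exists 1, (fun _ _ => 0%C). split; [lra|]. intros a z w Ha Hz Hw. simpl.
  replace (1 - 1 - (w - z) * 0)%C with (RtoC 0) by ring. rewrite Cmod_0, Cmod_1.
  repeat split; try lra. rewrite Rmult_1_l. pose proof (Cmod_ge_0 (w - z)%C). nra.
- set (d1 := fun a z => (Cconj a * szego a z * szego a z)%C).
  (* The second-order remainder of the product needs all three summands; the value needs T M and the
     derivative T M + T^2 M. The 3 comes from [R3], where |w - z| <= 2. *)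
  exists (T * M + 3 * (T * T * M) + T * T * T * M).
  exists (fun a z => d1 a z * szego a z ^ N + szego a z * d a z)%C.
  assert (0 <= T * M) by nra. assert (0 <= T * T * M) by (apply Rmult_le_pos; nra).
  assert (0 <= T * T * T * M) by (apply Rmult_le_pos; [|lra]; repeat apply Rmult_le_pos; lra).
  split; [lra|]. intros a z w Ha Hz Hw.
  destruct (IH a z w Ha Hz Hw) as (I1 & I2 & I3).
  destruct (IH a w w Ha Hw Hw) as (J1 & _ & _).
  pose proof (Hs a z Ha Hz) as Sz. pose proof (Hs a w Ha Hw) as Sw.
  assert (Ca : Cmod (Cconj a) <= 1) by (rewrite Cmod_conj; unfold in_disk in Ha; lra).
  assert (P2 : forall x y (X Y : R), Cmod x <= X -> Cmod y <= Y -> Cmod (x * y)%C <= X * Y).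
  { intros x y X Y Hx Hy. rewrite Cmod_mult. apply Rmult_le_compat; auto; apply Cmod_ge_0. }
  assert (D1 : Cmod (d1 a z) <= T * T).
  { unfold d1. replace (T * T) with (1 * T * T) by ring. repeat apply P2; auto. }
  repeat split.
  + simpl. eapply Rle_trans; [apply (P2 _ _ T M Sz I1)|]. lra.
  + eapply Rle_trans; [apply Cmod_triangle|].
    pose proof (P2 _ _ _ _ D1 I1). pose proof (P2 _ _ _ _ Sz I2). lra.
  + set (D := Cmod (w - z)%C) in *. assert (HD : 0 <= D) by apply Cmod_ge_0.
    (* product rule for second-order remainders *)
    replace (szego a w ^ S N - szego a z ^ S N - (w - z) * (d1 a z * szego a z ^ N + szego a z * d a z))%C
    with ((szego a w - szego a z - (w - z) * d1 a z) * szego a w ^ N +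
          szego a z * (szego a w ^ N - szego a z ^ N - (w - z) * d a z) +
          (w - z) * d1 a z * (szego a w ^ N - szego a z ^ N))%C by (simpl; ring).
    assert (R1 : Cmod (szego a w - szego a z - (w - z) * d1 a z)%C <= T * T * T * D ^ 2).
    { rewrite Hd by auto. unfold d1.
      replace (Cconj a * (w - z) * szego a w * szego a z - (w - z) * (Cconj a * szego a z * szego a z))%C
        with (Cconj a * (w - z) * szego a z * (szego a w - szego a z))%C by ring.
      rewrite Hd by auto.
      replace (T * T * T * D ^ 2) with (1 * D * T * (1 * D * T * T)) by ring.
      repeat apply P2; auto; unfold D; lra. }
    assert (HD2 : D <= 2) by (pose proof (Cmod_sub_le w z) as Hwz; fold D in Hwz; lra).
    assert (R3 : Cmod (szego a w ^ N - szego a z ^ N)%C <= 3 * M * D).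
    { replace (szego a w ^ N - szego a z ^ N)%C with
       ((szego a w ^ N - szego a z ^ N - (w - z) * d a z) + (w - z) * d a z)%C by ring.
      eapply Rle_trans; [apply Cmod_triangle|].
      pose proof (P2 (w - z)%C _ D M ltac:(unfold D; lra) I2).
      assert (M * D ^ 2 <= M * (2 * D)) by (apply Rmult_le_compat_l; simpl; nra). lra. }
    pose proof (P2 _ _ _ _ R1 J1) as Q1. pose proof (P2 _ _ _ _ Sz I3) as Q2.
    pose proof (P2 _ _ _ _ (P2 (w - z)%C _ D _ ltac:(unfold D; lra) D1) R3) as Q3.
    eapply Rle_trans; [apply Cmod_triangle|].
    eapply Rle_trans; [apply Rplus_le_compat_r, Cmod_triangle|]. simpl in *. lra.
Qed.

Theorem CSeries_hump_analytic (N : nat) (k : R) (a : nat -> C) :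
  (forall n, in_disk (a n)) -> ex_series (fun n => Rpower (1 - Cmod (a n)) (INR N - k)) ->
  analytic_on_disk (fun z => CSeries (fun n => hump N k (a n) z)).
Proof.
intros Ha Hc z Hz. apply ex_derive_cderiv. unfold in_disk in Hz. pose proof (Cmod_ge_0 z) as Hz0.
set (c := fun n => Rpower (1 - Cmod (a n)) (INR N - k)) in *.
assert (Hc0 : forall n, 0 < c n) by (intros; apply Rpower_pos).
set (rho := (1 + Cmod z) / 2).
destruct (szego_pow_taylor N rho) as (M & d & HM & H); [unfold rho; lra|].
assert (SC : forall x, ex_series (fun n => x * c n))
  by (intros x; exact (ex_series_scal_l (K := R_AbsRing) (V := R_NormedModule) x c Hc)).
assert (S1 : forall w, Cmod w <= rho -> csummable (fun n => hump N k (a n) w)).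
{ intros w Hw. apply (csummable_le _ (fun n => M * c n)); auto. intros n.
  unfold hump. rewrite Cmod_mult, Cmod_R, Rabs_pos_eq by (left; apply Rpower_pos). fold (c n).
  rewrite Rmult_comm. apply Rmult_le_compat_r; [left; auto|]. apply (H (a n) w w); auto. }
assert (S2 : csummable (fun n => RtoC (c n) * d (a n) z)%C).
{ apply (csummable_le _ (fun n => M * c n)); auto. intros n.
  rewrite Cmod_mult, Cmod_R, Rabs_pos_eq by (left; apply Hc0).
  rewrite Rmult_comm. apply Rmult_le_compat_r; [left; auto|].
  apply (H (a n) z z); auto; unfold rho; lra. }
exists (CSeries (fun n => RtoC (c n) * d (a n) z)%C).
intros eps Heps.
(* The summed remainders are at most M |w - z|^2 times the sum of [c]; adding 1 makes [K] positive
   even if [M] is 0. *)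
set (K := M * Series c + 1).
assert (HS : 0 <= Series c).
{ pose proof (Cmod_CSeries_le (fun _ => 0%C) c Hc) as Hp.
  eapply Rle_trans; [apply Cmod_ge_0|apply Hp]. intros n; rewrite Cmod_0; left; auto. }
assert (HK : 0 < K) by (unfold K; nra).
exists (Rmin ((1 - Cmod z) / 2) (eps / K)); split.
{ apply Rmin_glb_lt; [lra|now apply Rdiv_lt_0_compat]. }
intros w Hw.
assert (Hw1 : Cmod (w - z)%C < (1 - Cmod z) / 2) by (eapply Rlt_le_trans; [exact Hw|apply Rmin_l]).
assert (Hw2 : Cmod (w - z)%C < eps / K) by (eapply Rlt_le_trans; [exact Hw|apply Rmin_r]).
assert (Hwr : Cmod w <= rho).
{ pose proof (Cmod_triangle_inv w z). unfold rho; lra. }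
assert (Hzr : Cmod z <= rho) by (unfold rho; lra).
set (D := Cmod (w - z)%C) in *. assert (HD : 0 <= D) by apply Cmod_ge_0.
rewrite Cmult_comm, <- CSeries_mult_l, <- !CSeries_minus by auto using csummable_minus, csummable_mult_l.
apply (Rle_trans _ (Series (fun n => (M * D ^ 2) * c n))).
- apply Cmod_CSeries_le; auto. intros n. unfold hump. fold (c n).
  replace (c n * szego (a n) w ^ N - c n * szego (a n) z ^ N - (w - z) * (c n * d (a n) z))%C
    with (RtoC (c n) * (szego (a n) w ^ N - szego (a n) z ^ N - (w - z) * d (a n) z))%C by ring.
  rewrite Cmod_mult, Cmod_R, Rabs_pos_eq by (left; apply Hc0).
  rewrite Rmult_comm. apply Rmult_le_compat_r; [left; auto|]. apply (H (a n) z w); auto.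
- rewrite Series_scal_l.
  apply (Rmult_lt_compat_r K) in Hw2; auto. unfold Rdiv in Hw2.
  rewrite Rmult_assoc, Rinv_l, Rmult_1_r in Hw2 by lra.
  replace (M * D ^ 2 * Series c) with (D * (M * Series c) * D) by ring.
  apply Rmult_le_compat_r; auto. unfold K in Hw2. lra.
Qed.

(** * Sparse sums of kernel functions *)

Section SparseHumps.

Variables (p : Rbar) (alpha e : R) (N : nat) (b : nat -> C -> C).
Hypothesis Hp : Rbar_lt (Finite 0) p.
Hypothesis Halpha : 0 < alpha.
Hypothesis He : 0 < e.

Let k := kappa p alpha.

Hypothesis HN : k + 1 <= INR N.
Hypothesis HNp : forall q, p = Finite q -> 2 <= INR N * q.
Hypothesis Hb : forall n z, in_disk z -> in_disk (b n z).

Let K := hump N k.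
Let gap (z : C) : R := 1 - Cmod z.

(** [Q] stands for everything that the earlier points demand of the next one, and [b n] will be the
    semigroup map at the n-th time. *)
Hypothesis Hstep : forall n Q, 0 < Q -> exists a, in_disk a /\
  gap a <= (/ 2) ^ n /\ Rpower (gap a) alpha * Q <= e /\ gap a * Q <= e * (/ 2) ^ n /\
  Rpower (gap a) k * Cmod (K a (b n a)) <= e.

(** For m < n, the first comparison makes the earlier kernel K_{a_m} negligible in weighted supremum
    on circles at least as close to the boundary as a_n. The other two make the later kernel K_{a_n}
    negligible at points no closer to the boundary than a_m, and than its image [b m (a m)]. *)
Definition sparse (a : nat -> C) : Prop :=
  (forall n, in_disk (a n)) /\
  (forall n, gap (a n) <= (/ 2) ^ n) /\
  (forall n, Rpower (gap (a n)) k * Cmod (K (a n) (b n (a n))) <= e) /\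
  forall m n, (m < n)%nat ->
    Rpower (gap (a n)) alpha * Rpower (gap (a m)) (- k) <= e * (/ 2) ^ m /\
    gap (a n) * Rpower (gap (a m)) (- INR N) <= e * (/ 2) ^ n /\
    gap (a n) * Rpower (gap (b m (a m))) (- INR N) <= e * (/ 2) ^ n.

Lemma sparse_ex : exists a, sparse a.
Proof.
assert (Hstep' : forall nQ : nat * R, exists a, 0 < snd nQ -> in_disk a /\
  gap a <= (/ 2) ^ fst nQ /\ Rpower (gap a) alpha * snd nQ <= e /\
  gap a * snd nQ <= e * (/ 2) ^ fst nQ /\ Rpower (gap a) k * Cmod (K a (b (fst nQ) a)) <= e).
{ intros [n Q]; simpl. destruct (Rlt_dec 0 Q) as [HQ|HQ].
  - destruct (Hstep n Q HQ) as [a Ha]; exists a; auto.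
  - exists 0%C; intros; contradiction. }
set (g := fun nQ => proj1_sig (constructive_indefinite_description _ (Hstep' nQ))).
assert (Hg : forall n Q, 0 < Q -> in_disk (g (n, Q)) /\
  gap (g (n, Q)) <= (/ 2) ^ n /\ Rpower (gap (g (n, Q))) alpha * Q <= e /\
  gap (g (n, Q)) * Q <= e * (/ 2) ^ n /\ Rpower (gap (g (n, Q))) k * Cmod (K (g (n, Q)) (b n (g (n, Q)))) <= e).
{ intros n Q HQ. unfold g. destruct (constructive_indefinite_description _ (Hstep' (n, Q))) as [a Ha].
  exact (Ha HQ). }
clearbody g.
(* [Q n] accumulates the demands of all earlier points. The factor 2^n is there because the first
   comparison must decay in the earlier index, over which it is later summed. *)
set (Q := fix Q n := match n with O => 1 | S n => Q n + 2 ^ n * Rpower (gap (g (n, Q n))) (- k) +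
   Rpower (gap (g (n, Q n))) (- INR N) + Rpower (gap (b n (g (n, Q n)))) (- INR N) end).
assert (H2 : forall n, 0 < 2 ^ n) by (intros; apply pow_lt; lra).
assert (Hinc : forall n, Q n <= Q (S n)).
{ intros n; simpl. pose proof (Rpower_pos (gap (g (n, Q n))) (- INR N)).
  pose proof (Rpower_pos (gap (b n (g (n, Q n)))) (- INR N)).
  pose proof (Rmult_lt_0_compat _ _ (H2 n) (Rpower_pos (gap (g (n, Q n))) (- k))). lra. }
assert (Hmon : forall m n, (m <= n)%nat -> Q m <= Q n).
{ intros m n Hmn; induction Hmn; [lra|]. pose proof (Hinc m0); lra. }
assert (HQ : forall n, 0 < Q n) by (intros n; pose proof (Hmon 0%nat n (Nat.le_0_l n)) as H0; simpl in H0; lra).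
exists (fun n => g (n, Q n)).
split; [intros n; apply (Hg n (Q n) (HQ n))|].
split; [intros n; apply (Hg n (Q n) (HQ n))|].
split; [intros n; apply (Hg n (Q n) (HQ n))|].
intros m n Hmn.
pose proof (Hmon (S m) n Hmn) as Hm. simpl in Hm. pose proof (HQ m).
destruct (Hg n (Q n) (HQ n)) as (G1 & G2 & G3 & G4 & G5).
set (an := g (n, Q n)) in *. set (am := g (m, Q m)) in *.
pose proof (Rpower_pos (gap am) (- INR N)). pose proof (Rpower_pos (gap (b m am)) (- INR N)).
pose proof (Rmult_lt_0_compat _ _ (H2 m) (Rpower_pos (gap am) (- k))).
pose proof (Rpower_pos (gap an) alpha).
assert (Hgap : 0 < gap an) by (unfold gap, in_disk in *; lra).
repeat split.
- apply (Rmult_le_reg_l (2 ^ m)); auto.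
  replace (2 ^ m * (e * (/ 2) ^ m)) with e.
  2:{ rewrite pow_inv. field. apply Rgt_not_eq, H2. }
  eapply Rle_trans; [|exact G3].
  replace (2 ^ m * (Rpower (gap an) alpha * Rpower (gap am) (- k))) with
    (Rpower (gap an) alpha * (2 ^ m * Rpower (gap am) (- k))) by ring.
  apply Rmult_le_compat_l; lra.
- eapply Rle_trans; [|exact G4]. apply Rmult_le_compat_l; lra.
- eapply Rle_trans; [|exact G4]. apply Rmult_le_compat_l; lra.
Qed.

(** * Estimates for a fixed sparse sequence *)

Variable a : nat -> C.
Hypothesis Ha : sparse a.

Lemma gap_pos z : in_disk z -> 0 < gap z <= 1.
Proof. unfold in_disk, gap; pose proof (Cmod_ge_0 z); lra. Qed.

Lemma Cmod_hump_le_center c z : in_disk c -> in_disk z -> Cmod (K c z) <= Rpower (gap c) (- k).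
Proof.
intros Hc Hz. unfold K. rewrite Cmod_hump by auto. fold (gap c).
pose proof (gap_pos c Hc). pose proof (one_minus_lower c z).
assert (gap c <= Cmod (1 - Cconj c * z)%C).
{ unfold gap, in_disk in *. pose proof (Cmod_ge_0 c); pose proof (Cmod_ge_0 z). nra. }
assert (ln (gap c) <= ln (Cmod (1 - Cconj c * z)%C)) by (apply ln_le; lra).
apply ln_le_cancel; [ln_pos|ln_pos|]. ln_expand. pose proof (pos_INR N). nra.
Qed.

(** Here |1 - conj(c) z| >= 1 - |z| >= x, and N - k >= 1 leaves at least one factor [gap c]. Any
    lower bound [x] of the gap is allowed, so that the gap of a sequence point can be used for a
    whole circle. *)
Lemma Cmod_hump_le_point c z x : in_disk c -> in_disk z -> 0 < x <= gap z ->
  Cmod (K c z) <= gap c * Rpower x (- INR N).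
Proof.
intros Hc Hz Hx. unfold K. rewrite Cmod_hump by auto. fold (gap c).
pose proof (gap_pos c Hc). pose proof (one_minus_lower c z).
assert (gap z <= Cmod (1 - Cconj c * z)%C).
{ unfold gap, in_disk in *. pose proof (Cmod_ge_0 c); pose proof (Cmod_ge_0 z). nra. }
assert (ln x <= ln (Cmod (1 - Cconj c * z)%C)) by (apply ln_le; lra).
assert (ln (gap c) <= 0) by (rewrite <- ln_1; apply ln_le; lra).
apply ln_le_cancel; [ln_pos|ln_pos|]. ln_expand. pose proof (pos_INR N). nra.
Qed.

Lemma is_series_half (x : R) : is_series (fun n => x * (/ 2) ^ n) (x * 2).
Proof.
assert (H : is_series (fun n => (/ 2) ^ n) (/ (1 - / 2)))
  by (apply is_series_geom; rewrite Rabs_pos_eq; lra).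
replace (/ (1 - / 2)) with 2 in H by field.
exact (is_series_scal_l (K := R_AbsRing) (V := R_NormedModule) x _ _ H).
Qed.

Lemma ex_series_half (x : R) : ex_series (fun n => x * (/ 2) ^ n).
Proof. eexists; apply is_series_half. Qed.

Lemma sparse_coeff_summable : ex_series (fun n => Rpower (1 - Cmod (a n)) (INR N - k)).
Proof.
destruct Ha as (A1 & A2 & _).
apply (ex_series_le (V := R_CompleteNormedModule) _ (fun n => 1 * (/ 2) ^ n)); [|apply ex_series_half].
intros n. change (Rabs (Rpower (1 - Cmod (a n)) (INR N - k)) <= 1 * (/ 2) ^ n).
rewrite Rabs_pos_eq, Rmult_1_l by (left; apply Rpower_pos).
eapply Rle_trans; [|apply A2]. fold (gap (a n)). pose proof (gap_pos (a n) (A1 n)).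
assert (ln (gap (a n)) <= 0) by (rewrite <- ln_1; apply ln_le; lra).
apply ln_le_cancel; [ln_pos|lra|]. ln_expand. nra.
Qed.

Definition humps (z : C) : C := CSeries (fun n => K (a n) z).

Lemma humps_analytic : analytic_on_disk humps.
Proof.
apply CSeries_hump_analytic; [apply Ha|apply sparse_coeff_summable].
Qed.

Lemma humps_summable z : in_disk z -> csummable (fun n => K (a n) z).
Proof.
intros Hz. destruct Ha as (A1 & A2 & _). pose proof (gap_pos z Hz) as Hg.
apply (csummable_le _ (fun n => Rpower (gap z) (- INR N) * (/ 2) ^ n)); [apply ex_series_half|].
intros n. eapply Rle_trans; [apply (Cmod_hump_le_point _ _ (gap z)); auto; lra|].
rewrite Rmult_comm. apply Rmult_le_compat_l; [left; apply Rpower_pos|auto].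
Qed.

Lemma humps_in_H : in_H p alpha humps.
Proof.
split; [apply humps_analytic|].
destruct Ha as (A1 & A2 & A3 & A4). pose proof (kappa_ge p alpha Hp) as Hk; fold k in Hk.
apply (Hnorm_two_humps p alpha (e * 2) N); auto; [fold k; lra|lra|apply humps_analytic|].
fold k. fold K.
intros r Hr. set (x := 1 - r). assert (Hx : 0 < x <= 1) by (unfold x; lra).
assert (Hexj : exists j, gap (a j) < x).
{ assert (Hg : is_lim_seq (fun n => (/ 2) ^ n) 0) by (apply is_lim_seq_geom; rewrite Rabs_pos_eq; lra).
  apply is_lim_seq_spec in Hg. destruct (Hg (mkposreal x (proj1 Hx))) as [n Hn]; simpl in Hn.
  specialize (Hn n (le_n n)). rewrite Rminus_0_r, Rabs_pos_eq in Hn by (left; apply pow_lt; lra).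
  exists n. pose proof (A2 n). lra. }
(* The circle lies between a_{J-1} and a_J: terms before J - 1 are controlled by the weight, terms
   after J by the distance of the circle from the boundary. *)
destruct (dec_inh_nat_subset_has_unique_least_element (fun j => gap (a j) < x)) as [J [[HJ HJmin] _]].
{ intros n; apply classic. }
{ exact Hexj. }
(* For J = 0 both centres coincide; the repeated kernel only enlarges the upper bound. *)
exists (a (pred J)), (a J). split; [auto|split; [auto|]]. intros th.
set (z := polar r th). assert (Hz : in_disk z) by now apply in_disk_polar.
assert (Hgz : gap z = x) by (unfold gap, z, x; rewrite Cmod_polar; lra).
set (w := Rpower x alpha). assert (Hw : 0 < w) by apply Rpower_pos.
assert (Hw1 : w <= 1).
{ assert (ln x <= 0) by (rewrite <- ln_1; apply ln_le; lra).
  apply ln_le_cancel; [auto|lra|]. unfold w. rewrite ln_Rpower, ln_1. nra. }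
set (u := fun n => K (a n) z).
set (v := fun n => if Nat.eqb n J then RtoC 0 else u n).
set (v' := fun n => if Nat.eqb n (pred J) then RtoC 0 else v n).
assert (Hu : csummable u) by now apply humps_summable.
assert (Hv : csummable v).
{ apply (csummable_le _ (fun n => Cmod (u n))); auto. intros n; unfold v.
  destruct (Nat.eqb n J); [rewrite Cmod_0; apply Cmod_ge_0|lra]. }
assert (Hsmall : forall n, w * Cmod (v' n) <= e * (/ 2) ^ n).
{ intros n. unfold v', v, u.
  assert (H0 : 0 <= e * (/ 2) ^ n) by (apply Rmult_le_pos; [lra|apply pow_le; lra]).
  destruct (Nat.eqb_spec n (pred J)); [rewrite Cmod_0; lra|].
  destruct (Nat.eqb_spec n J); [rewrite Cmod_0; lra|].
  destruct (Nat.lt_ge_cases n J) as [Hn|Hn].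
  - assert (Hxj : x <= gap (a (pred J))).
    { destruct (Rle_lt_dec x (gap (a (pred J)))) as [|Hlt]; auto.
      specialize (HJmin _ Hlt). lia. }
    destruct (A4 n (pred J) ltac:(lia)) as (B1 & _).
    eapply Rle_trans; [|exact B1].
    apply Rmult_le_compat; [lra|apply Cmod_ge_0| |now apply Cmod_hump_le_center].
    unfold w; apply Rpower_le_l; lra.
  - destruct (A4 J n ltac:(lia)) as (_ & B2 & _).
    eapply Rle_trans; [|exact B2].
    pose proof (gap_pos (a J) (A1 J)).
    pose proof (Cmod_hump_le_point (a n) z (gap (a J)) (A1 n) Hz ltac:(lra)).
    pose proof (Cmod_ge_0 (K (a n) z)). nra. }
assert (E1 : humps z = (u J + CSeries v)%C) by exact (CSeries_remove u J Hu).
assert (E2 : CSeries v = (v (pred J) + CSeries v')%C) by exact (CSeries_remove v (pred J) Hv).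
assert (Hv' : w * Cmod (CSeries v') <= e * 2).
{ replace (w * Cmod (CSeries v')) with (Cmod (CSeries (fun n => RtoC w * v' n)%C)).
  2:{ rewrite CSeries_mult_l, Cmod_mult, Cmod_R, Rabs_pos_eq; auto; [lra|].
      apply (csummable_le _ (fun n => Cmod (v n))); auto. intros n; unfold v'.
      destruct (Nat.eqb n (pred J)); [rewrite Cmod_0; apply Cmod_ge_0|lra]. }
  rewrite <- (is_series_unique _ _ (is_series_half e)).
  apply Cmod_CSeries_le; [apply ex_series_half|].
  intros n. rewrite Cmod_mult, Cmod_R, Rabs_pos_eq by lra. auto. }
assert (Hvp : Cmod (v (pred J)) <= Cmod (u (pred J))).
{ unfold v. destruct (Nat.eqb (pred J) J); [rewrite Cmod_0; apply Cmod_ge_0|lra]. }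
rewrite E1, E2.
pose proof (Cmod_triangle (u J) (v (pred J) + CSeries v')%C) as T1.
pose proof (Cmod_triangle (v (pred J)) (CSeries v')) as T2.
change (w * Cmod (u J + (v (pred J) + CSeries v'))%C <= w * Cmod (u (pred J)) + w * Cmod (u J) + e * 2).
nra.
Qed.

(** The n-th kernel gives at least 2^-N at a_n and at most e at its image. Every other index m
    contributes at most e 2^-m at each of the two points, in total 4 e. *)
Lemma humps_lower n : (/ 2) ^ N - 5 * e <=
  Rpower (gap (a n)) k * Cmod (humps (b n (a n)) - humps (a n))%C.
Proof.
destruct Ha as (A1 & A2 & A3 & A4). pose proof (kappa_ge p alpha Hp) as Hk; fold k in Hk.
set (x := a n) in *. assert (Hx : in_disk x) by apply A1.
set (y := b n x) in *. assert (Hy : in_disk y) by now apply Hb.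
pose proof (gap_pos x Hx) as Gx. pose proof (gap_pos y Hy) as Gy.
set (w := Rpower (gap x) k). assert (Hw : 0 < w) by apply Rpower_pos.
assert (Lx : ln (gap x) <= 0) by (rewrite <- ln_1; apply ln_le; lra).
assert (Hw1 : w <= 1) by (apply ln_le_cancel; [auto|lra|]; unfold w; rewrite ln_Rpower, ln_1; nra).
(* Since k >= alpha, the comparison stated with the weight exponent alpha also serves the exponent
   k. *)
assert (Hwa : w <= Rpower (gap x) alpha).
{ apply ln_le_cancel; [auto|ln_pos|]. unfold w; rewrite !ln_Rpower. nra. }
unfold humps. rewrite <- CSeries_minus by now apply humps_summable.
set (u := fun m => (K (a m) y - K (a m) x)%C).
assert (Hu : csummable u) by (apply csummable_minus; now apply humps_summable).
rewrite (CSeries_remove u n Hu).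
set (v := fun m => if Nat.eqb m n then RtoC 0 else u m).
change (fun m : nat => if Nat.eqb m n then RtoC 0 else u m) with v.
assert (Hrest : w * Cmod (CSeries v) <= 2 * e * 2).
{ replace (w * Cmod (CSeries v)) with (Cmod (CSeries (fun m => RtoC w * v m)%C)).
  2:{ rewrite CSeries_mult_l, Cmod_mult, Cmod_R, Rabs_pos_eq; auto; [lra|].
      apply (csummable_le _ (fun n => Cmod (u n))); auto. intros m; unfold v.
      destruct (Nat.eqb m n); [rewrite Cmod_0; apply Cmod_ge_0|lra]. }
  rewrite <- (is_series_unique _ _ (is_series_half (2 * e))).
  apply Cmod_CSeries_le; [apply ex_series_half|].
  intros m. rewrite Cmod_mult, Cmod_R, Rabs_pos_eq by lra. unfold v.
  assert (H0 : 0 <= 2 * e * (/ 2) ^ m) by (apply Rmult_le_pos; [lra|apply pow_le; lra]).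
  destruct (Nat.eqb_spec m n); [rewrite Cmod_0; lra|].
  assert (Ht : w * Cmod (u m) <= w * Cmod (K (a m) y) + w * Cmod (K (a m) x)).
  { rewrite <- Rmult_plus_distr_l. apply Rmult_le_compat_l; [lra|apply Cmod_sub_le]. }
  destruct (Nat.lt_ge_cases m n) as [Hm|Hm].
  - destruct (A4 m n Hm) as (B1 & _). fold x in B1.
    assert (Hz : forall z, in_disk z -> w * Cmod (K (a m) z) <= e * (/ 2) ^ m).
    { intros z Hz. eapply Rle_trans; [|exact B1].
      apply Rmult_le_compat; [lra|apply Cmod_ge_0|auto|now apply Cmod_hump_le_center]. }
    pose proof (Hz x Hx). pose proof (Hz y Hy). lra.
  - destruct (A4 n m ltac:(lia)) as (_ & B2 & B3). fold x in B2, B3. fold y in B3.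
    pose proof (Cmod_hump_le_point (a m) x (gap x) (A1 m) Hx ltac:(lra)).
    pose proof (Cmod_hump_le_point (a m) y (gap y) (A1 m) Hy ltac:(lra)).
    pose proof (Cmod_ge_0 (K (a m) x)). pose proof (Cmod_ge_0 (K (a m) y)). nra. }
specialize (A3 n). fold x in A3. fold y in A3. fold w in A3.
(* The right side is the N-th power of (1 - |x|) / (1 - |x|^2) = 1 / (1 + |x|). *)
assert (Hmain : (/ 2) ^ N <= w * Cmod (K x x)).
{ unfold K. rewrite Cmod_hump by auto. fold (gap x).
  assert (Hxx : (1 - Cconj x * x)%C = RtoC (1 - Cmod x ^ 2)).
  { rewrite RtoC_minus. rewrite <- (Cmult_comm x). rewrite Cmod2_conj. reflexivity. }
  rewrite Hxx, Cmod_R. unfold gap in *. unfold in_disk in Hx. pose proof (Cmod_ge_0 x).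
  rewrite Rabs_pos_eq by (simpl; nra).
  rewrite <- Rpower_pow by lra.
  assert (H1 : 0 < 1 - Cmod x ^ 2) by (simpl; nra).
  assert (L : ln (1 - Cmod x ^ 2) <= ln 2 + ln (1 - Cmod x)).
  { rewrite <- ln_mult by lra. apply ln_le; [auto|simpl; nra]. }
  apply ln_le_cancel; [ln_pos|unfold w; ln_pos|]. unfold w. ln_expand.
  pose proof (pos_INR N). nra. }
change (u n) with (K x y - K x x)%C.
pose proof (Cmod_triangle_inv (K x x) (K x y)) as T1. rewrite Cmod_sub_sym in T1.
pose proof (Cmod_triangle_inv (K x y - K x x)%C (- CSeries v)%C) as T2.
rewrite Cmod_opp in T2.
replace (K x y - K x x - - CSeries v)%C with (K x y - K x x + CSeries v)%C in T2 by ring.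
nra.
Qed.

End SparseHumps.

(** * Semigroups *)

Lemma analytic_minus_id (g : C -> C) : analytic_on_disk g ->
  analytic_on_disk (fun z => g z - z)%C.
Proof.
intros Hg z Hz. apply ex_derive_cderiv. destruct (analytic_cderiv g z Hg Hz) as [l Hl].
exists (l - 1)%C. apply (cderiv_minus g (fun z => z)); auto.
intros eps Heps; exists 1; split; [lra|]; intros w _.
replace (w - z - 1 * (w - z))%C with (RtoC 0) by ring.
rewrite Cmod_0; apply Rmult_le_pos; [lra|apply Cmod_ge_0].
Qed.

Lemma boundary_displacement (g : C -> C) (z1 : C) : analytic_on_disk g -> in_disk z1 ->
  g z1 <> z1 -> exists d r0, 0 < d /\ r0 < 1 /\ forall r, 0 <= r < 1 -> r0 < r ->
    exists a, Cmod a = r /\ d <= Cmod (g a - a)%C.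
Proof.
intros Hg Hz Hne. pose proof PI_RGT_0 as Hpi. unfold in_disk in Hz.
set (h := fun z => (g z - z)%C).
assert (Hh : analytic_on_disk h) by now apply analytic_minus_id.
assert (Hm : 0 < Cmod (h z1)) by (apply Cmod_gt_0, Cminus_eq_contra, Hne).
set (m := Cmod (h z1)) in *. pose proof (Cmod_ge_0 z1) as Hz0.
(* If |h| <= d on a circle with r - |z1| > (1 - |z1|) / 2, the Cauchy estimate gives m <= 2 d / (r -
   |z1|) < m / 2. *)
set (d := m * (1 - Cmod z1) / 8).
assert (Hd : 0 < d) by (unfold d; apply Rdiv_lt_0_compat; nra).
exists d, ((1 + Cmod z1) / 2). split; [auto|split; [lra|]].
intros r Hr Hr0. apply NNPP; intros Hn.
assert (Hlt : forall th, Cmod (h (polar r th)) <= d).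
{ intros th. apply Rnot_lt_le; intros H. apply Hn. exists (polar r th).
  split; [apply Cmod_polar; lra|]. left; exact H. }
pose proof (cauchy_estimate h z1 r Hh ltac:(lra) ltac:(lra)) as Hc. fold m in Hc.
assert (Hi : RInt (fun th => Cmod (h (polar r th))) 0 (2 * PI) <= 2 * PI * d).
{ replace (2 * PI * d) with (RInt (fun _ => d) 0 (2 * PI)) by (rewrite RInt_Rconst, Rminus_0_r; reflexivity).
  apply RInt_le; [lra| | |auto].
  - apply (ex_RInt_continuous (V := R_CompleteNormedModule)); intros.
    apply continuous_Cmod, continuous_analytic_polar; auto.
  - apply ex_RInt_const. }
assert (Hp : 0 < PI * (r - Cmod z1)) by (apply Rmult_lt_0_compat; lra).
apply (Rmult_le_compat_l (PI * (r - Cmod z1))) in Hc; [|lra].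
rewrite <- Rmult_assoc, Rinv_r, Rmult_1_l in Hc by lra.
assert (Hc2 : PI * (r - Cmod z1) * m <= 2 * PI * d) by lra.
unfold d in Hc2.
assert (Hq : (1 - Cmod z1) / 2 < r - Cmod z1) by lra.
assert (Hmz : 0 < m * (1 - Cmod z1)) by nra.
assert (PI * ((r - Cmod z1) * m) <= PI * (m * (1 - Cmod z1) / 4)) by lra.
assert ((r - Cmod z1) * m <= m * (1 - Cmod z1) / 4) by (apply (Rmult_le_reg_l PI); lra).
nra.
Qed.

Lemma hump_step (alpha e k : R) (N n : nat) (Q : R) (g : C -> C) (z1 : C) :
  0 < alpha -> 0 < e -> 0 <= k -> k + 1 <= INR N -> 0 < Q ->
  analytic_on_disk g -> (forall z, in_disk z -> in_disk (g z)) -> in_disk z1 -> g z1 <> z1 ->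
  exists a, in_disk a /\
  1 - Cmod a <= (/ 2) ^ n /\ Rpower (1 - Cmod a) alpha * Q <= e /\
  (1 - Cmod a) * Q <= e * (/ 2) ^ n /\
  Rpower (1 - Cmod a) k * Cmod (hump N k a (g a)) <= e.
Proof.
intros Hal He Hk HN HQ Hg Hself Hz1 Hne.
destruct (boundary_displacement g z1 Hg Hz1 Hne) as (d & r0 & Hd & Hr0 & H).
assert (H2n : 0 < (/ 2) ^ n) by (apply pow_lt; lra).
(* [x] is the future 1 - |a|. The bounds 1/2 and d/8 keep the kernel's denominator above d/4, and e
   d/4 then makes the kernel's value at most e. *)
assert (Hsm : exists x, 0 < x /\ x < 1 - r0 /\ x <= (/ 2) ^ n /\ x <= Rpower (e / Q) (/ alpha) /\
  x <= e * (/ 2) ^ n / Q /\ x <= / 2 /\ x <= d / 8 /\ x <= e * d / 4).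
{ assert (X4 : 0 < Rpower (e / Q) (/ alpha)) by apply Rpower_pos.
  assert (X5 : 0 < e * (/ 2) ^ n / Q) by ln_pos.
  assert (X8 : 0 < e * d / 4) by ln_pos.
  set (x := Rmin ((1 - r0) / 2) (Rmin ((/ 2) ^ n) (Rmin (Rpower (e / Q) (/ alpha))
    (Rmin (e * (/ 2) ^ n / Q) (Rmin (/ 2) (Rmin (d / 8) (e * d / 4))))))).
  exists x. split; [unfold x; repeat apply Rmin_glb_lt; lra|].
  assert (M1 : forall u v w, u <= v -> Rmin w u <= v) by (intros u v y Hv; eapply Rle_trans; [apply Rmin_r|auto]).
  split; [apply (Rle_lt_trans _ ((1 - r0) / 2)); [apply Rmin_l|lra]|].
  repeat split; unfold x; repeat first [apply Rmin_l | apply Rmin_r | apply M1]. }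
destruct Hsm as (x & X0 & X1 & X2 & X3 & X4 & X5 & X6 & X7).
destruct (H (1 - x) ltac:(lra) ltac:(lra)) as (a & Ha & Hda).
assert (Hin : in_disk a) by (unfold in_disk; lra).
exists a. replace (1 - Cmod a) with x by lra.
split; [auto|]. split; [auto|].
split; [|split].
- apply (Rmult_le_reg_r (/ Q)); [now apply Rinv_0_lt_compat|].
  rewrite Rmult_assoc, Rinv_r, Rmult_1_r by lra. fold (e / Q).
  apply ln_le_cancel; [ln_pos|ln_pos|]. rewrite ln_Rpower.
  apply ln_le in X3; [|auto]. rewrite ln_Rpower in X3.
  apply (Rmult_le_compat_l alpha) in X3; [|lra].
  rewrite <- Rmult_assoc, Rinv_r, Rmult_1_l in X3 by lra. exact X3.
- apply (Rmult_le_compat_r Q) in X4; [|lra]. unfold Rdiv in X4.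
  rewrite Rmult_assoc, Rinv_l, Rmult_1_r in X4 by lra. exact X4.
- rewrite Cmod_hump by auto. replace (1 - Cmod a) with x by lra.
  set (X := Cmod (1 - Cconj a * g a)%C).
  (* |conj(a) (a - g a)| >= d / 2, while 1 - |a|^2 <= 2 x <= d / 4. *)
  assert (HX : d / 4 <= X).
  { unfold X. rewrite Cmod_sub_sym in Hda.
    assert (E : (1 - Cconj a * g a)%C = (Cconj a * (a - g a) - - RtoC (1 - Cmod a ^ 2))%C).
    { rewrite RtoC_minus, Cmod2_conj. ring. }
    rewrite E. eapply Rle_trans; [|apply Cmod_triangle_inv].
    rewrite Cmod_mult, Cmod_conj, Cmod_opp, Cmod_R, Ha.
    rewrite Rabs_pos_eq by (simpl; nra).
    assert (/ 2 * d <= (1 - x) * Cmod (a - g a)%C) by (apply Rmult_le_compat; lra).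
    simpl; nra. }
  assert (HX0 : 0 < X) by lra.
  assert (L1 : ln x <= ln X) by (apply ln_le; lra).
  assert (L2 : ln x <= ln e + ln X).
  { rewrite <- ln_mult by lra. apply ln_le; [auto|]. nra. }
  (* The quantity is (x / X)^N, at most x / X because N >= 1 and x <= X, hence at most e. *)
  apply ln_le_cancel; [ln_pos|auto|]. ln_expand. nra.
Qed.

(** Read contrapositively: a point moved at time t0 is moved at every time t0 / n, which supplies
    arbitrarily small times at which the map is not the identity. *)
Lemma semigroup_fixes_iterates (phi : R -> C -> C) (s : R) (z : C) : analytic_semigroup phi ->
  0 <= s -> in_disk z -> phi s z = z -> forall m, phi (INR m * s) z = z.
Proof.
intros (_ & _ & H0 & Hadd & _) Hs Hz Hfix m. induction m as [|m IH].
- simpl. rewrite Rmult_0_l. auto.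
- rewrite S_INR. replace ((INR m + 1) * s) with (INR m * s + s) by ring.
  rewrite Hadd; auto; [now rewrite Hfix|]. apply Rmult_le_pos; [apply pos_INR|auto].
Qed.

Theorem theorem6p2 (p : Rbar) (alpha : R)
  (hp : Rbar_lt (Finite 0) p) (halpha : 0 < alpha)
  (phi : R -> C -> C) (hphi : analytic_semigroup phi)
  (hnt : ~ trivial_semigroup phi) :
  exists f : C -> C, in_H p alpha f /\ ~ in_strong_cont p alpha phi f.
Proof.
assert (Hnt : exists t0 z0, 0 < t0 /\ in_disk z0 /\ phi t0 z0 <> z0).
{ apply NNPP; intros Hn. apply hnt. intros t z Ht Hz. apply NNPP; intros Hne.
  destruct Ht as [Ht| <-]; [apply Hn; exists t, z; auto|]. apply Hne, hphi, Hz. }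
destruct Hnt as (t0 & z0 & Ht0 & Hz0 & Hne).
set (t := fun n => t0 / INR (S n)).
assert (Ht : forall n, 0 < t n).
{ intros n. apply Rdiv_lt_0_compat; auto. apply lt_0_INR; lia. }
assert (Hmove : forall n, phi (t n) z0 <> z0).
{ intros n E. apply Hne.
  pose proof (semigroup_fixes_iterates phi (t n) z0 hphi ltac:(left; auto) Hz0 E (S n)) as H.
  replace (INR (S n) * t n) with t0 in H; auto. unfold t. field. apply not_0_INR; lia. }
pose proof hphi as (Han & Hself & _ & _ & _).
set (k := kappa p alpha).
pose proof (kappa_ge p alpha hp) as Hk. fold k in Hk.
assert (HN : exists N, k + 1 <= INR N /\ forall q, p = Finite q -> 2 <= INR N * q).
{ destruct p as [q| |]; simpl in hp; [| |contradiction].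
  - destruct (INR_unbounded (Rmax (k + 1) (2 / q))) as [N HN]. exists N.
    pose proof (Rmax_l (k + 1) (2 / q)); pose proof (Rmax_r (k + 1) (2 / q)).
    split; [lra|]. intros q' [= <-].
    replace 2 with (2 / q * q) by (field; lra). apply Rmult_le_compat_r; lra.
  - destruct (INR_unbounded (k + 1)) as [N HN]. exists N. split; [lra|discriminate]. }
destruct HN as (N & HN & HNp).
set (c := (/ 2) ^ N). assert (Hc : 0 < c) by (apply pow_lt; lra).
(* This leaves c - 5 e = c / 2 as a lower bound, against the upper bound c / 4 that strong
   continuity and point evaluation would give with tolerance c / (4 C0). *)
set (e := c / 10). assert (He : 0 < e) by (unfold e; lra).
destruct (sparse_ex p alpha e N (fun n => phi (t n))) as [a Ha]; auto.
{ intros n Q HQ. apply (hump_step alpha e k N n Q (phi (t n)) z0); auto; try lra.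
  - apply Han; left; auto.
  - intros; apply Hself; auto; left; auto. }
assert (Hb : forall n z, in_disk z -> in_disk (phi (t n) z)) by (intros; apply Hself; auto; left; auto).
set (f := humps p alpha N a).
assert (Hf : in_H p alpha f).
{ eapply humps_in_H; eauto. }
exists f. split; [exact Hf|]. intros [_ Hsc].
destruct (point_evaluation p alpha hp halpha) as (C0 & HC0 & Hev).
destruct (Hsc (c / (4 * C0))) as (delta & Hdelta & Hd); [ln_pos|].
assert (Hn : exists n, t n < delta).
{ destruct (INR_unbounded (t0 / delta)) as [n Hn]. exists n. unfold t.
  pose proof (pos_INR n). rewrite S_INR.
  apply (Rmult_lt_reg_r (INR n + 1)); [lra|]. unfold Rdiv. rewrite Rmult_assoc, Rinv_l, Rmult_1_r by lra.
  apply (Rmult_gt_compat_r delta) in Hn; auto. unfold Rdiv in Hn.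
  rewrite Rmult_assoc, Rinv_l in Hn by lra. lra. }
destruct Hn as [n Hn].
specialize (Hd (t n) (conj (Ht n) Hn)).
assert (Hfa : analytic_on_disk f) by apply Hf.
assert (Hh : analytic_on_disk (fun z => Cminus (f (phi (t n) z)) (f z))).
{ intros z Hz. apply ex_derive_cderiv.
  destruct (analytic_cderiv f z Hfa Hz) as [l1 H1].
  destruct (analytic_cderiv f (phi (t n) z) Hfa (Hb n z Hz)) as [l2 H2].
  destruct (analytic_cderiv (phi (t n)) z (Han (t n) ltac:(left; auto)) Hz) as [l3 H3].
  eexists. apply cderiv_minus; [exact (cderiv_comp f (phi (t n)) z l2 l3 H2 H3)|exact H1]. }
assert (Hin : in_disk (a n)) by apply Ha.
assert (Heps : 0 < c / (4 * C0)) by ln_pos.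
pose proof (Hev _ Hh _ Heps Hd (a n) Hin) as Hup. fold k in Hup.
replace (C0 * (c / (4 * C0))) with (c / 4) in Hup by (field; lra).
assert (Hlow : c - 5 * e <= Rpower (1 - Cmod (a n)) k * Cmod (f (phi (t n) (a n)) - f (a n))%C).
{ eapply (humps_lower p alpha e N (fun n => phi (t n))); eauto. }
unfold e in Hlow. lra.
Qed.
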